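(* Let $X$ be a Banach space and $(b_n)_{n\in\mathbb{N}}\in\ell^\infty(X)$. Define $a_n=\frac{b_n}{n}$ for every $n\in\mathbb{N}$. Then the Dirichlet series $$f(z)=\sum_{n=1}^\infty\frac{a_n}{n^z}$$ is analytic in $\{z\in\mathbb{C} : \mathrm{Re}(z)>0\}$. Let $M:[0,\infty)\to[1,\infty)$ be a continuous, increasing function and define $R:[0,\infty)\to[1,\infty]$ by $R(t)=e^t$. Put $C=e\cdot\max\{\sup_{n}\|b_n\|,1\}$. Assume that $f$ has an analytic extension (again denoted $f$) into the region $$Q=\left\{z=x+iy\in\mathbb{C} : 0\ge x>-\frac{1}{M(|y|)}\right\}$$ such that $\|f(z)\|\le M(|y|)$ holds for all $z=x+iy\in Q$. Then there exist $K>0$ and $T'\ge 0$ such that $$\left\|\sum_{\log n<t}a_n-f(0)\right\|\le K\max\left\{\frac{1}{M_{\log}^{-1}\left(\frac t4\right)},\frac{1}{R(t)}\right\}$$ for every $t>T'$, where $M_{\log}^{-1}$ is the inverse of the function $M_{\log}$ defined by $$M_{\log}(a)=M(a)\left(\log a+\log M(a)-\tfrac12\log(5C)\right),\qquad a\ge 1.$$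
   Context: $\mathbb{N}=\{1,2,3,\dots\}$ and $\ell^\infty(X)$ is the space of bounded sequences in $X$. ''Increasing'' means non-decreasing. ''Analytic extension into $Q$'' means that $f$ extends analytically from $\{\mathrm{Re}(z)>0\}$ to $\{\mathrm{Re}(z)>0\}\cup Q$; $f(0)$ is the value at $0$ of this extension. $M_{\log}^{-1}(s)$ is the unique $a\ge1$ with $M_{\log}(a)=s$; it is well defined for all sufficiently large $s$. *)

(* Defs.v *)
From Stdlib Require Import Reals Lra.
From Coquelicot Require Import Coquelicot.
Open Scope R_scope.

(* Sequences (x_n) with n = 1, 2, 3, ... are functions on [nat] whose value
   at 0 is never used. *)

Definition bounded_seq {X : NormedModule C_AbsRing} (b : nat -> X) : Prop :=
  exists B : R, forall n : nat, (1 <= n)%nat -> norm (b n) <= B.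

(* [real] of an [Rbar]: the finite supremum of the norms when [b] is bounded. *)
Definition sup_norm {X : NormedModule C_AbsRing} (b : nat -> X) : R :=
  real (Sup_seq (fun k => Finite (norm (b (S k))))).

Definition Cexp (z : C) : C :=
  (exp (Re z) * cos (Im z), exp (Re z) * sin (Im z)).

(* n ^ z for n >= 1 *)
Definition nat_Cpower (n : nat) (z : C) : C := Cexp (z * RtoC (ln (INR n)))%C.

Definition dirichlet_term {X : NormedModule C_AbsRing} (a : nat -> X) (z : C)
  (n : nat) : X := scal (/ nat_Cpower n z)%C (a n).

(* Series are indexed from 0 in the library, whence the shift.  [iota] picks the
   sum when the series converges. *)
Definition dirichlet_series {X : CompleteNormedModule C_AbsRing}
  (a : nat -> X) (z : C) : X :=
  iota (is_series (fun k => dirichlet_term a z (S k))).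

Definition analytic_at {X : NormedModule C_AbsRing} (f : C -> X) (z0 : C) :
  Prop :=
  exists (r : R) (c : nat -> X), 0 < r /\
    forall z : C, Cmod (z - z0)%C < r ->
      is_pseries (K := C_AbsRing) c (z - z0)%C (f z).

(* Meant for open [D]: [f] is a total function, but for open [D] the condition
   only involves its values on [D]. *)
Definition analytic_on {X : NormedModule C_AbsRing} (D : C -> Prop)
  (f : C -> X) : Prop := forall z : C, D z -> analytic_at f z.

Definition right_half_plane (z : C) : Prop := 0 < Re z.

Definition region_Q (M : R -> R) (z : C) : Prop :=
  Re z <= 0 /\ - (1 / M (Rabs (Im z))) < Re z.

(* [F] extends [f] analytically from the right half-plane to its union with
   [Q]; that union is open when [Q = region_Q M] with [M] continuous. *)
Definition analytic_extension {X : NormedModule C_AbsRing} (Q : C -> Prop)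
  (f F : C -> X) : Prop :=
  (forall z : C, right_half_plane z -> F z = f z) /\
  analytic_on (fun z => right_half_plane z \/ Q z) F.

(* Since [ln n < t] forces [n < exp t < up (exp t)], the range of the sum is
   large enough to contain all n >= 1 with [ln n < t]. *)
Definition sum_log_lt {X : NormedModule C_AbsRing} (a : nat -> X) (t : R) : X :=
  sum_n (fun k => if Rlt_dec (ln (INR (S k))) t then a (S k) else zero)
    (Z.to_nat (up (exp t))).

Definition M_log (M : R -> R) (c : R) (a : R) : R :=
  M a * (ln a + ln (M a) - 1 / 2 * ln (5 * c)).

Definition M_log_inv (M : R -> R) (c : R) (s : R) : R :=
  iota (T := R_CompleteNormedModule) (fun a : R => 1 <= a /\ M_log M c a = s).

Lemma M_log_inv_spec (M : R -> R) (c : R)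
  (M_ge1 : forall x, 0 <= x -> 1 <= M x)
  (M_cont : continuous_on (fun x => 0 <= x) M)
  (M_incr : forall x y, 0 <= x -> x <= y -> M x <= M y) :
  exists s0 : R, forall s : R, s0 < s ->
    (exists! a : R, 1 <= a /\ M_log M c a = s) /\
    1 <= M_log_inv M c s /\ M_log M c (M_log_inv M c s) = s.
Proof.
exists (Rmax 0 (M_log M c 1)); intros s Hs.
assert (Hs0 : 0 < s) by (apply Rle_lt_trans with (2 := Hs), Rmax_l).
assert (Hs1 : M_log M c 1 < s) by (apply Rle_lt_trans with (2 := Hs), Rmax_r).
assert (U : exists! a : R, 1 <= a /\ M_log M c a = s).
{ assert (incr : forall a b, 1 <= a -> a < b ->
            M_log M c a = s -> M_log M c b = s -> False).
  { unfold M_log; intros a b Ha Hab Ea Eb.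
    assert (H1 := M_ge1 a ltac:(lra)).
    assert (H2 := M_incr a b ltac:(lra) ltac:(lra)).
    assert (H3 : ln a < ln b) by (apply ln_increasing; lra).
    assert (H4 : ln (M a) <= ln (M b)) by (apply ln_le; lra).
    set (k := 1 / 2 * ln (5 * c)) in *.
    assert (0 < ln a + ln (M a) - k).
    { destruct (Rlt_le_dec 0 (ln a + ln (M a) - k)) as [h|h]; [exact h|].
      exfalso; nra. }
    nra. }
  set (k := 1 / 2 * ln (5 * c)).
  set (h := fun x => M_log M c (Rmax 1 x)).
  assert (Hh : continuity h).
  { intro x; apply continuity_pt_filterlim.
    assert (C1 : filterlim (Rmax 1) (locally x) (locally (Rmax 1 x))).
    { apply continuity_pt_filterlim.
      apply continuity_pt_ext with (fun y => (1 + y + Rabs (1 - y)) / 2).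
      { intro y; unfold Rmax, Rabs; destruct (Rle_dec 1 y), (Rcase_abs (1 - y));
        lra. }
      reg. }
    assert (P : 1 <= Rmax 1 x) by apply Rmax_l.
    assert (C2 : filterlim (fun y => M (Rmax 1 y)) (locally x)
                   (locally (M (Rmax 1 x)))).
    { intros A HA.
      assert (B := M_cont (Rmax 1 x) ltac:(lra) A HA).
      generalize (C1 _ B); unfold filtermap, within.
      apply filter_imp; intros y Hy; apply Hy.
      assert (1 <= Rmax 1 y) by apply Rmax_l; lra. }
    assert (P2 := M_ge1 (Rmax 1 x) ltac:(lra)).
    assert (C1' : continuity_pt (Rmax 1) x)
      by (apply continuity_pt_filterlim; exact C1).
    assert (C2' : continuity_pt (fun y => M (Rmax 1 y)) x)
      by (apply continuity_pt_filterlim; exact C2).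
    apply continuity_pt_filterlim.
    apply (continuity_pt_mult (fun y => M (Rmax 1 y))
      (fun y => ln (Rmax 1 y) + ln (M (Rmax 1 y)) - k)); [exact C2'|].
    apply (continuity_pt_minus
      (fun y => ln (Rmax 1 y) + ln (M (Rmax 1 y))) (fun _ => k));
      [|apply continuity_pt_const; intros ? ?; reflexivity].
    apply (continuity_pt_plus (fun y => ln (Rmax 1 y))
      (fun y => ln (M (Rmax 1 y)))).
    - apply (continuity_pt_comp (Rmax 1) ln); [exact C1'|].
      apply derivable_continuous_pt.
      exists (/ Rmax 1 x); apply derivable_pt_lim_ln; lra.
    - apply (continuity_pt_comp (fun y => M (Rmax 1 y)) ln); [exact C2'|].
      apply derivable_continuous_pt.
      exists (/ M (Rmax 1 x)); apply derivable_pt_lim_ln; lra. }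
  set (b := Rmax 1 (exp (s + k))).
  assert (b1 : 1 <= b) by apply Rmax_l.
  assert (Hb : s <= h b).
  { unfold h; rewrite (Rmax_right 1 b b1).
    unfold M_log; fold k.
    assert (H1 := M_ge1 b ltac:(lra)).
    assert (s + k <= ln b).
    { rewrite <- (ln_exp (s + k)); apply ln_le; [apply exp_pos|apply Rmax_r]. }
    assert (0 <= ln (M b)) by (rewrite <- ln_1; apply ln_le; lra).
    nra. }
  assert (H1 : h 1 = M_log M c 1) by (unfold h; rewrite Rmax_left; lra).
  destruct (IVT_cor (fun x => h x - s) 1 b) as [a [Ha Ea]].
  { intro x; apply (continuity_pt_minus h (fun _ => s)); [apply Hh|].
    apply continuity_pt_const; intros ? ?; reflexivity. }
  { exact b1. }
  { nra. }
  assert (Ea' : M_log M c a = s)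
    by (unfold h in Ea; rewrite Rmax_right in Ea; lra).
  exists a; split; [split; [lra|exact Ea']|].
  intros a' [Ha' E'].
  destruct (Rtotal_order a a') as [L|[L|L]]; [exfalso|exact L|exfalso].
  - exact (incr a a' ltac:(lra) L Ea' E').
  - exact (incr a' a Ha' L E' Ea'). }
split; [exact U|].
exact (iota_correct (V := R_CompleteNormedModule) _ U).
Qed.

(* Main.v *)
(* Newman's contour argument on rectangles. Put [T = M_log^{-1}(t/4)] and let [S] be the partial
   sum of the series over [log n < t]. By Cauchy's formula [f(0) - S(0)] is controlled by the
   integral of [e^(tz) (1 + z^2/T^2) (f(z) - S(z)) / z] over the boundary of
   [[-d, T] x [-T, T]] with [d = 1 / (2 M(T))]. In the right half plane [f - S] is a tail of the
   series, of size [e^(-tx) (1/x + e^(-t))], and the zeros of the kernel at [iT] and [-iT] absorb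
   the factor [1/x]. In the left half plane [S] is entire with a similar bound and its contour is
   pushed to [Re z = -T], while [f] is bounded by [M(T)] and
   [e^(-dt) = 5C / (T M(T))^2] by the choice of [T]. Everything is [O(1/T + e^(-t))]. *)

(* The bounds for [f - S] at Re z = x and for [S] at Re z = -x carry exactly the exponentials that
   [e^(tz)] cancels, so there the gain must come from the rest of the kernel. Hence the two summands
   part ways on the left: at Re z = -d the integrand of [S] would only be of order [1/d^2], that is
   [M(T)^2], whereas at Re z = -T it is of order [(1/T + e^(-t)) / T]. For [f] the decay [e^(-dt)]
   has to beat [M(T)/d = 2 M(T)^2] and still leave [1/T^2] against a side of length [2T]; the shape
   of [M_log] provides this. A square can replace Newman's circle: on y = T and y = -T one has
   [1 + z^2/T^2 = x (x + 2iy) / T^2], still divisible by x, and on x = T and x = -T the factor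
   [1/|x|] is already [1/T]. Only segments parallel to the axes then occur, and Goursat's bisection
   yields the Cauchy theory for values in a Banach space directly. The term [e^(-t)] is the price of
   the sharp cut at [log n = t]: comparison with an integral leaves out one term next to the cut. *)
Require Import Defs.
From Stdlib Require Import Reals.
From Stdlib Require Import Lra Lia Psatz List Factorial.
From Coquelicot Require Import Coquelicot.
Open Scope R_scope.

(** * Restriction of scalars and linear identities *)

(* The library integrates functions with values in real normed modules. *)
Section restriction_of_scalars.
Variable X : CompleteNormedModule C_AbsRing.

Definition restr_ModuleSpace_mixin : ModuleSpace.mixin_of R_Ring X.
Proof.
apply (ModuleSpace.Mixin R_Ring X (fun r x => scal (RtoC r) x)).
- intros r s u; rewrite (@scal_assoc C_Ring X); f_equal.
  apply (eq_sym (RtoC_mult r s)).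
- intros u; exact (@scal_one C_Ring X u).
- intros r u v; exact (@scal_distr_l C_Ring X (RtoC r) u v).
- intros r s u; rewrite <- (@scal_distr_r C_Ring X); f_equal.
  exact (RtoC_plus r s).
Defined.

Definition restr_NormedModuleAux : NormedModuleAux R_AbsRing :=
  NormedModuleAux.Pack R_AbsRing X
    (NormedModuleAux.Class R_AbsRing X
      (ModuleSpace.Class R_Ring X (AbelianGroup.class X) restr_ModuleSpace_mixin)
      (UniformSpace.class X)) X.

Definition restr_NormedModule_mixin :
  NormedModule.mixin_of R_AbsRing restr_NormedModuleAux.
Proof.
apply (NormedModule.Mixin R_AbsRing restr_NormedModuleAux
  (@norm C_AbsRing X) (@norm_factor C_AbsRing X)).
- exact (@norm_triangle C_AbsRing X).
- intros l x; apply Rle_trans with (1 := @norm_scal C_AbsRing X (RtoC l) x).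
  apply Req_le; change (abs (RtoC l)) with (Cmod (RtoC l)).
  rewrite Cmod_R; reflexivity.
- exact (@norm_compat1 C_AbsRing X).
- exact (@norm_compat2 C_AbsRing X).
- exact (@norm_eq_zero C_AbsRing X).
Defined.

(** Only the scalars change: carrier, uniform structure and norm are those of [X] up to conversion,
    which is why the mixins end with [Defined]. Bounds and limits pass between the two structures
    without transport. *)
Definition restr : CompleteNormedModule R_AbsRing :=
  CompleteNormedModule.Pack R_AbsRing X
    (CompleteNormedModule.Class R_AbsRing X
      (NormedModule.Class R_AbsRing X (NormedModuleAux.class _ restr_NormedModuleAux)
        restr_NormedModule_mixin)
      (CompleteSpace.class X)) X.
End restriction_of_scalars.

Section linear_combinations.
Context {X : ModuleSpace C_Ring}.

(** Reification for linear identities: equal coefficients on every atom force equal vectors, so that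
    [leval_eq] leaves goals in [C] for [ring] or [field]. *)
Inductive lexpr : Type :=
| LVar (n : nat) | LZero | LPlus (u v : lexpr) | LOpp (u : lexpr)
| LMinus (u v : lexpr) | LScal (c : C) (u : lexpr).

Fixpoint leval (l : list X) (e : lexpr) : X :=
  match e with
  | LVar n => nth n l zero
  | LZero => zero
  | LPlus u v => plus (leval l u) (leval l v)
  | LOpp u => opp (leval l u)
  | LMinus u v => minus (leval l u) (leval l v)
  | LScal c u => scal c (leval l u)
  end.

Fixpoint lcoef (e : lexpr) (i : nat) : C :=
  match e with
  | LVar n => if Nat.eqb n i then 1%C else 0%C
  | LZero => 0%C
  | LPlus u v => (lcoef u i + lcoef v i)%C
  | LOpp u => (- lcoef u i)%C
  | LMinus u v => (lcoef u i - lcoef v i)%C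
  | LScal c u => (c * lcoef u i)%C
  end.

Fixpoint lcomb (c : nat -> C) (l : list X) : X :=
  match l with
  | nil => zero
  | cons x l => plus (scal (c O) x) (lcomb (fun i => c (S i)) l)
  end.

Lemma lcomb_ext (l : list X) (c d : nat -> C) :
  (forall i, (i < length l)%nat -> c i = d i) -> lcomb c l = lcomb d l.
Proof.
revert c d; induction l as [|x l IH]; intros c d H; simpl; [reflexivity|].
rewrite (H O); [|simpl; lia]; f_equal; apply IH.
intros i Hi; apply H; simpl; lia.
Qed.

Lemma lcomb_zero (l : list X) : lcomb (fun _ => 0%C) l = zero.
Proof.
induction l as [|x l IH]; simpl; [reflexivity|].
rewrite IH; rewrite plus_zero_r; exact (@scal_zero_l C_Ring X x).
Qed.

Lemma lcomb_plus (l : list X) (c d : nat -> C) :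
  lcomb (fun i => (c i + d i)%C) l = plus (lcomb c l) (lcomb d l).
Proof.
revert c d; induction l as [|x l IH]; intros c d; simpl.
- now rewrite plus_zero_l.
- rewrite (IH (fun i => c (S i)) (fun i => d (S i))).
  replace (scal (c 0%nat + d 0%nat)%C x) with (plus (scal (c O) x) (scal (d O) x))
    by (symmetry; apply (@scal_distr_r C_Ring X)).
  rewrite <- !plus_assoc; f_equal; rewrite !plus_assoc; f_equal; apply plus_comm.
Qed.

Lemma lcomb_scal (l : list X) (k : C) (c : nat -> C) :
  lcomb (fun i => (k * c i)%C) l = scal k (lcomb c l).
Proof.
revert c; induction l as [|x l IH]; intros c; simpl.
- symmetry; apply (@scal_zero_r C_Ring X).
- rewrite (IH (fun i => c (S i))), scal_distr_l; f_equal.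
  symmetry; apply (@scal_assoc C_Ring X).
Qed.

Lemma leval_correct (l : list X) (e : lexpr) : leval l e = lcomb (lcoef e) l.
Proof.
assert (scal_m1 : forall x : X, scal (- (1))%C x = opp x)
  by (intros x; exact (@scal_opp_one C_Ring X x)).
induction e as [n| |u IHu v IHv|u IHu|u IHu v IHv|k u IHu]; simpl.
- revert n; induction l as [|x l IH]; intros [|n]; simpl; auto.
  + rewrite lcomb_zero, plus_zero_r; symmetry; exact (@scal_one C_Ring X x).
  + rewrite IH.
    replace (scal (RtoC 0) x) with (@zero X) by (symmetry; exact (@scal_zero_l C_Ring X x)).
    now rewrite plus_zero_l.
- now rewrite lcomb_zero.
- now rewrite lcomb_plus, IHu, IHv.
- rewrite (lcomb_ext l _ (fun i => (- (1) * lcoef u i)%C)) by (intros; ring).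
  now rewrite lcomb_scal, scal_m1, IHu.
- rewrite (lcomb_ext l _ (fun i => (lcoef u i + - (1) * lcoef v i)%C))
    by (intros; ring).
  now rewrite lcomb_plus, (lcomb_scal l (- (1))%C), scal_m1, IHu, IHv.
- now rewrite lcomb_scal, IHu.
Qed.

Lemma leval_eq (l : list X) (e1 e2 : lexpr) :
  (forall i, (i < length l)%nat -> lcoef e1 i = lcoef e2 i) ->
  leval l e1 = leval l e2.
Proof. intros H; rewrite !leval_correct; now apply lcomb_ext. Qed.
End linear_combinations.

Ltac lmem x l :=
  lazymatch l with
  | nil => constr:(false)
  | cons x _ => constr:(true)
  | cons _ ?l' => lmem x l'
  end.

Ltac latoms l e :=
  lazymatch e with
  | plus ?u ?v => let l := latoms l u in latoms l v
  | minus ?u ?v => let l := latoms l u in latoms l v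
  | opp ?u => latoms l u
  | scal ?c ?u => latoms l u
  | zero => l
  | _ => lazymatch lmem e l with true => l | false => constr:(cons e l) end
  end.

Ltac lindex x l :=
  lazymatch l with
  | cons x _ => constr:(O)
  | cons _ ?l' => let n := lindex x l' in constr:(S n)
  end.

Ltac lreify l e :=
  lazymatch e with
  | plus ?u ?v =>
      let u := lreify l u in let v := lreify l v in constr:(LPlus u v)
  | minus ?u ?v =>
      let u := lreify l u in let v := lreify l v in constr:(LMinus u v)
  | opp ?u => let u := lreify l u in constr:(LOpp u)
  | scal ?c ?u => let u := lreify l u in constr:(LScal c u)
  | zero => constr:(LZero)
  | _ => let n := lindex e l in constr:(LVar n)
  end.

Ltac module_reify :=
  lazymatch goal with
  | |- @eq ?T ?a ?b =>
      let l := latoms (@nil T) a in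
      let l := latoms l b in
      let ea := lreify l a in
      let eb := lreify l b in
      apply (leval_eq l ea eb)
  end.

(* Proves an equation between linear combinations by comparing in [C] the coefficients
   of each atom; [module_coefs] leaves these scalar equations as goals. *)
Ltac module_coefs :=
  module_reify;
  let i := fresh "i" in let Hi := fresh "Hi" in
  intros i Hi; simpl in Hi;
  repeat (destruct i as [|i]; [clear Hi|
    first [solve [exfalso; lia] | apply PeanoNat.Nat.succ_lt_mono in Hi]]);
  cbn [lcoef Nat.eqb].

Ltac module_ring := module_coefs; ring.

(** * Complex differentiability *)

(* Differentiability with a quadratic remainder: it holds for analytic functions, is stable under
   products, and makes the estimate in Goursat's theorem immediate. *)
Definition holo_at {X : NormedModule C_AbsRing} (h : C -> X) (z0 : C) : Prop :=
  exists (l : X) (A r : R), 0 < r /\ 0 <= A /\ forall z : C, Cmod (z - z0) < r ->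
    norm (minus (minus (h z) (h z0)) (scal (z - z0)%C l)) <= A * Cmod (z - z0) ^ 2.

Lemma norm_scal_C {X : NormedModule C_AbsRing} (c : C) (x : X) :
  norm (scal c x) <= Cmod c * norm x.
Proof. exact (norm_scal c x). Qed.

Lemma norm_minus_le {X : NormedModule C_AbsRing} (x y : X) :
  norm (minus x y) <= norm x + norm y.
Proof.
unfold minus; apply Rle_trans with (1 := @norm_triangle C_AbsRing X _ _).
rewrite norm_opp; lra.
Qed.

Section holo.
Context {X : NormedModule C_AbsRing}.

Lemma holo_at_lipschitz (h : C -> X) (z0 : C) : holo_at h z0 ->
  exists L r : R, 0 < r /\ 0 <= L /\ forall z : C, Cmod (z - z0) < r ->
    norm (minus (h z) (h z0)) <= L * Cmod (z - z0).
Proof.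
intros (l & A & r & r0 & A0 & H).
exists (A + norm l), (Rmin 1 r); split; [apply Rmin_glb_lt; lra|].
split; [assert (h0 := norm_ge_0 l); lra|].
intros z Hz.
assert (Hz1 : Cmod (z - z0) < 1) by (apply Rlt_le_trans with (1 := Hz), Rmin_l).
assert (Hz2 : Cmod (z - z0) < r) by (apply Rlt_le_trans with (1 := Hz), Rmin_r).
specialize (H z Hz2).
replace (minus (h z) (h z0)) with
  (plus (minus (minus (h z) (h z0)) (scal (z - z0)%C l)) (scal (z - z0)%C l))
  by module_ring.
apply Rle_trans with (1 := @norm_triangle C_AbsRing X _ _).
assert (h1 := norm_scal_C (z - z0)%C l).
assert (h2 := Cmod_ge_0 (z - z0)%C); assert (h3 := norm_ge_0 l).
assert (A * Cmod (z - z0) ^ 2 <= A * Cmod (z - z0)).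
{ apply Rmult_le_compat_l; nra. }
lra.
Qed.

Lemma holo_at_ext_loc (h g : C -> X) (z0 : C) (d : R) : 0 < d ->
  (forall z, Cmod (z - z0) < d -> h z = g z) -> holo_at h z0 -> holo_at g z0.
Proof.
intros d0 E (l & A & r & r0 & A0 & H).
exists l, A, (Rmin d r); split; [apply Rmin_glb_lt; lra|]; split; [lra|].
intros z Hz; rewrite <- !E.
- apply H; apply Rlt_le_trans with (1 := Hz), Rmin_r.
- replace (z0 - z0)%C with (RtoC 0) by ring; rewrite Cmod_0; lra.
- apply Rlt_le_trans with (1 := Hz), Rmin_l.
Qed.

Lemma holo_at_ext (h g : C -> X) (z0 : C) :
  (forall z, h z = g z) -> holo_at h z0 -> holo_at g z0.
Proof. intros E; apply holo_at_ext_loc with 1; [lra|auto]. Qed.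

Lemma holo_at_const (v : X) (z0 : C) : holo_at (fun _ => v) z0.
Proof.
exists zero, 0, 1; split; [lra|split; [lra|]]; intros z _.
replace (minus _ _) with (@zero X) by module_ring.
rewrite (@norm_zero _ X); lra.
Qed.

Lemma holo_at_plus (g h : C -> X) (z0 : C) :
  holo_at g z0 -> holo_at h z0 -> holo_at (fun z => plus (g z) (h z)) z0.
Proof.
intros (l & A & r & r0 & A0 & H) (l' & A' & r' & r0' & A0' & H').
exists (plus l l'), (A + A'), (Rmin r r').
split; [apply Rmin_glb_lt; lra|]; split; [lra|]; intros z Hz.
specialize (H z (Rlt_le_trans _ _ _ Hz (Rmin_l _ _))).
specialize (H' z (Rlt_le_trans _ _ _ Hz (Rmin_r _ _))).
replace (minus _ _) with
  (plus (minus (minus (g z) (g z0)) (scal (z - z0)%C l))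
        (minus (minus (h z) (h z0)) (scal (z - z0)%C l'))) by module_ring.
apply Rle_trans with (1 := @norm_triangle C_AbsRing X _ _); lra.
Qed.

Lemma holo_at_scal (p : C -> C_NormedModule) (h : C -> X) (z0 : C) :
  holo_at p z0 -> holo_at h z0 -> holo_at (fun z => scal (p z : C) (h z)) z0.
Proof.
intros Hp Hh.
destruct (holo_at_lipschitz h z0 Hh) as (L & rL & rL0 & L0 & HL).
assert (Hp' : exists L r : R, 0 < r /\ 0 <= L /\ forall z : C, Cmod (z - z0) < r ->
    Cmod (p z) <= L).
{ destruct Hp as (q & A & r & r0 & A0 & H).
  exists (Cmod (p z0) + A + Cmod q), (Rmin 1 r).
  assert (h1 := Cmod_ge_0 (p z0)); assert (h2 := Cmod_ge_0 q).
  split; [apply Rmin_glb_lt; lra|]; split; [lra|]; intros z Hz.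
  specialize (H z (Rlt_le_trans _ _ _ Hz (Rmin_r _ _))).
  assert (Hz1 := Rlt_le_trans _ _ _ Hz (Rmin_l _ _)).
  change (Cmod ((p z - p z0) - (z - z0) * q)%C <= A * Cmod (z - z0) ^ 2) in H.
  replace (p z) with (p z0 + ((((p z - p z0) - (z - z0) * q)%C) + (z - z0) * q))%C
    by ring.
  apply Rle_trans with (1 := Cmod_triangle _ _).
  assert (h3 := Cmod_triangle ((p z - p z0) - (z - z0) * q)%C ((z - z0) * q)%C).
  rewrite Cmod_mult in h3.
  assert (h4 := Cmod_ge_0 (z - z0)%C).
  assert (A * Cmod (z - z0) ^ 2 <= A * 1) by (apply Rmult_le_compat_l; nra).
  assert (Cmod (z - z0) * Cmod q <= 1 * Cmod q) by (apply Rmult_le_compat_r; lra).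
  lra. }
destruct Hp' as (P & rP & rP0 & P0 & HP).
destruct Hp as (q & A & r & r0 & A0 & H).
destruct Hh as (l & A' & r' & r0' & A0' & H').
exists (plus (scal (p z0 : C) l) (scal (q : C) (h z0))).
exists (P * A' + A * norm (h z0) + A * norm l + Cmod q * norm l), (Rmin 1 (Rmin rP (Rmin r r'))).
assert (n1 := norm_ge_0 l); assert (n2 := norm_ge_0 (h z0)).
assert (n3 := Cmod_ge_0 q).
split; [repeat apply Rmin_glb_lt; lra|].
split; [nra|]; intros z Hz.
apply Rmin_Rgt in Hz; destruct Hz as [Hz1 Hz].
apply Rmin_Rgt in Hz; destruct Hz as [Hz2 Hz].
apply Rmin_Rgt in Hz; destruct Hz as [Hz3 Hz4].
specialize (H z Hz3); specialize (H' z Hz4); specialize (HP z Hz2).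
change (Cmod ((p z - p z0) - (z - z0) * q)%C <= A * Cmod (z - z0) ^ 2) in H.
set (e := ((p z - p z0) - (z - z0) * q)%C) in *.
set (w := (z - z0)%C) in *.
set (e' := minus (minus (h z) (h z0)) (scal w l)) in *.
(* Product rule: with [p z = p z0 + w q + e] and [h z = h z0 + w l + e'] the remainder is
   [p z e' + e h z0 + w (p z - p z0) l], where [p z - p z0 = e + w q]. Each summand is quadratic in
   [w]. *)
replace (minus _ _) with
  (plus (plus (scal (p z : C) e') (scal e (h z0)))
    (scal w (plus (scal e l) (scal (w * q)%C l)))).
2:{ unfold e', e; module_coefs; ring. }
assert (n4 := Cmod_ge_0 w); assert (n5 := Cmod_ge_0 e); assert (n6 := norm_ge_0 e').
assert (n7 := Cmod_ge_0 (p z)).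
assert (b1 := norm_scal_C (p z) e').
assert (b2 := norm_scal_C e (h z0)).
assert (b3 := norm_scal_C w (plus (scal e l) (scal (w * q)%C l))).
assert (b4 := norm_triangle (scal e l) (scal (w * q)%C l)).
assert (b5 := norm_scal_C e l).
assert (b6 := norm_scal_C (w * q)%C l).
rewrite Cmod_mult in b6.
apply Rle_trans with (1 := @norm_triangle C_AbsRing X _ _).
apply Rle_trans with (1 := Rplus_le_compat_r _ _ _ (@norm_triangle C_AbsRing X _ _)).
assert (c1 : norm (scal (p z : C) e') <= P * (A' * Cmod w ^ 2)).
{ apply Rle_trans with (1 := b1); apply Rmult_le_compat; lra. }
assert (c2 : norm (scal e (h z0)) <= (A * Cmod w ^ 2) * norm (h z0)).
{ apply Rle_trans with (1 := b2); apply Rmult_le_compat_r; lra. }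
assert (c3 : Cmod e <= A * Cmod w).
{ apply Rle_trans with (1 := H); apply Rmult_le_compat_l; nra. }
assert (c4 : norm (plus (scal e l) (scal (w * q)%C l)) <=
   A * Cmod w * norm l + Cmod w * Cmod q * norm l).
{ apply Rle_trans with (1 := b4); apply Rplus_le_compat; [|lra].
  apply Rle_trans with (1 := b5); apply Rmult_le_compat_r; lra. }
assert (c5 : norm (scal w (plus (scal e l) (scal (w * q)%C l))) <=
  Cmod w * (A * Cmod w * norm l + Cmod w * Cmod q * norm l)).
{ apply Rle_trans with (1 := b3); apply Rmult_le_compat_l; lra. }
lra.
Qed.

Lemma holo_at_scal_const (c : C) (h : C -> X) (z0 : C) :
  holo_at h z0 -> holo_at (fun z => scal c (h z)) z0.
Proof.
intros (l & A & r & r0 & A0 & H).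
exists (scal c l), (Cmod c * A), r; split; [lra|].
assert (c0 := Cmod_ge_0 c).
split; [nra|]; intros z Hz; specialize (H z Hz).
replace (minus _ _) with
  (scal c (minus (minus (h z) (h z0)) (scal (z - z0)%C l))) by module_ring.
apply Rle_trans with (1 := norm_scal_C _ _); rewrite Rmult_assoc.
apply Rmult_le_compat_l; lra.
Qed.

Lemma holo_at_minus (g h : C -> X) (z0 : C) :
  holo_at g z0 -> holo_at h z0 -> holo_at (fun z => minus (g z) (h z)) z0.
Proof.
intros Hg Hh.
apply holo_at_ext with (fun z => plus (g z) (scal (- (1))%C (h z))).
{ intros z; module_ring. }
apply holo_at_plus; [exact Hg|apply holo_at_scal_const, Hh].
Qed.

Lemma holo_at_sum_n (g : nat -> C -> X) (N : nat) (z0 : C) :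
  (forall k, holo_at (g k) z0) -> holo_at (fun z => sum_n (fun k => g k z) N) z0.
Proof.
intros H; induction N as [|N IH].
- apply holo_at_ext with (g O); [intros z; now rewrite sum_O|apply H].
- apply holo_at_ext with (fun z => plus (sum_n (fun k => g k z) N) (g (S N) z)).
  + intros z; now rewrite sum_Sn.
  + apply holo_at_plus; auto.
Qed.

End holo.

Lemma holo_at_id (z0 : C) : holo_at (X := C_NormedModule) (fun z => z) z0.
Proof.
exists (RtoC 1), 0, 1; split; [lra|split; [lra|]]; intros z _.
change (Cmod ((z - z0) - (z - z0) * RtoC 1)%C <= 0 * Cmod (z - z0) ^ 2).
replace ((z - z0) - (z - z0) * RtoC 1)%C with (RtoC 0) by ring.
rewrite Cmod_0; lra.
Qed.

(** The remainder is exactly [(z - z0)^2 / (z0^2 z)], and on the disc of radius [|z0| / 2] the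
    denominator is at least [|z0|^3 / 2]. *)
Lemma holo_at_inv (z0 : C) : z0 <> 0%C ->
  holo_at (X := C_NormedModule) (fun z => / z)%C z0.
Proof.
intros H0; assert (h0 : 0 < Cmod z0) by now apply Cmod_gt_0.
exists (- / (z0 * z0))%C, (2 / Cmod z0 ^ 3), (Cmod z0 / 2).
assert (h3 : 0 < Cmod z0 ^ 3) by (apply pow_lt; lra).
split; [lra|split; [apply Rlt_le, Rdiv_lt_0_compat; lra|]]; intros z Hz.
change (Cmod ((/ z - / z0) - (z - z0) * - / (z0 * z0))%C <=
  2 / Cmod z0 ^ 3 * Cmod (z - z0) ^ 2).
assert (hz : Cmod z0 / 2 <= Cmod z).
{ assert (h := Cmod_triangle z (- (z - z0))%C); rewrite Cmod_opp in h.
  replace (z + - (z - z0))%C with z0 in h by ring; lra. }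
assert (hz0 : z <> 0%C) by (apply Cmod_gt_0; lra).
replace ((/ z - / z0) - (z - z0) * - / (z0 * z0))%C with
  ((z - z0) * (z - z0) / (z0 * z0 * z))%C by (field; auto).
rewrite Cmod_div by (repeat apply Cmult_neq_0; auto).
rewrite !Cmod_mult.
set (w := Cmod (z - z0)) in *.
replace (2 / Cmod z0 ^ 3 * w ^ 2) with (w * w / (Cmod z0 * Cmod z0 * (Cmod z0 / 2)))
  by (field; lra).
apply Rmult_le_compat_l; [apply Rle_0_sqr|].
apply Rinv_le_contravar; [nra|].
apply Rmult_le_compat_l; [nra|lra].
Qed.

(** * Vector-valued series and differentiability of power series *)

Section series.
Context {X : NormedModule C_AbsRing}.

Lemma norm_sum_n_le (u : nat -> X) (v : nat -> R) (N : nat) :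
  (forall k, (k <= N)%nat -> norm (u k) <= v k) -> norm (sum_n u N) <= sum_n v N.
Proof.
intros H; induction N as [|N IH].
- rewrite !sum_O; apply H; lia.
- rewrite !sum_Sn; apply Rle_trans with (1 := norm_triangle _ _).
  apply Rplus_le_compat; [apply IH; intros; apply H|apply H]; lia.
Qed.

Lemma is_series_norm_minus_le (u : nat -> X) (l v : X) (B : R) (N0 : nat) :
  is_series u l -> (forall N, (N0 <= N)%nat -> norm (minus (sum_n u N) v) <= B) ->
  norm (minus l v) <= B.
Proof.
intros Hu HB; apply le_epsilon; intros eps Heps.
destruct (proj1 (filterlim_locally_ball_norm (K := C_AbsRing) _ l) Hu
  (mkposreal eps Heps)) as [N1 H1].
specialize (H1 (N0 + N1)%nat ltac:(lia)); unfold ball_norm in H1; simpl in H1.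
specialize (HB (N0 + N1)%nat ltac:(lia)).
set (y := sum_n u (N0 + N1)) in *.
replace (minus l v) with (minus (minus y v) (minus y l)) by module_ring.
apply Rle_trans with (1 := norm_minus_le _ _); lra.
Qed.

Lemma is_series_norm_le (u : nat -> X) (l : X) (B : R) :
  is_series u l -> (forall N, norm (sum_n u N) <= B) -> norm l <= B.
Proof.
intros Hu HB.
replace l with (minus l zero) by module_ring.
apply is_series_norm_minus_le with u O; [exact Hu|intros N _].
replace (minus _ _) with (sum_n u N) by module_ring; apply HB.
Qed.

Lemma is_series_bounded (u : nat -> X) (l : X) :
  is_series u l -> exists B, 0 <= B /\ forall k, norm (u k) <= B.
Proof.
intros Hu.
destruct (filterlim_bounded (sum_n u) (ex_intro _ l Hu)) as [B HB].
assert (B0 := Rle_trans _ _ _ (norm_ge_0 _) (HB O)).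
exists (B + B); split; [lra|]; intros [|k].
- rewrite <- (sum_O u); specialize (HB O); lra.
- replace (u (S k)) with (minus (sum_n u (S k)) (sum_n u k))
    by (rewrite sum_Sn; module_ring).
  apply Rle_trans with (1 := norm_minus_le _ _); apply Rplus_le_compat; apply HB.
Qed.

Lemma is_series_unique_C (u : nat -> X) (l l' : X) :
  is_series u l -> is_series u l' -> l = l'.
Proof. intros H H'; exact (filterlim_locally_unique (K := C_AbsRing) _ l l' H H'). Qed.

Lemma pow_n_Cpow (w : C) (k : nat) : pow_n (K := C_AbsRing) w k = (w ^ k)%C.
Proof. induction k as [|k IH]; simpl; [reflexivity|]; now rewrite IH. Qed.

(** Convergence at [w = r / 2] bounds the coefficients by [B (2/r)^k]. For [|w| < r / 4] the ratio
    [q = 2 |w| / r] is at most [1/2], so the terms from the second order on sum to at most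
    [2 B q^2]. *)
Lemma analytic_at_holo (h : C -> X) (z0 : C) : analytic_at h z0 -> holo_at h z0.
Proof.
intros (r & c & r0 & H).
assert (H' : forall w, Cmod w < r ->
  is_series (fun k => scal (w ^ k)%C (c k)) (h (z0 + w)%C)).
{ intros w Hw; specialize (H (z0 + w)%C).
  replace (z0 + w - z0)%C with w in H by ring.
  apply is_series_ext with (2 := H Hw); intros k; f_equal; apply pow_n_Cpow. }
assert (Hc : exists B, 0 <= B /\ forall k, norm (c k) <= B * (2 / r) ^ k).
{ assert (hr : Cmod (RtoC (r / 2)) = r / 2) by (rewrite Cmod_R, Rabs_pos_eq; lra).
  destruct (is_series_bounded _ _ (H' (RtoC (r / 2)) ltac:(lra))) as (B & B0 & HB).
  exists B; split; [exact B0|]; intros k.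
  assert (E : c k = scal (RtoC (2 / r) ^ k)%C (scal (RtoC (r / 2) ^ k)%C (c k))).
  { assert (Ek : (RtoC (2 / r) ^ k * RtoC (r / 2) ^ k)%C = RtoC 1).
    { rewrite <- Cpow_mult_l, <- RtoC_mult.
      replace (2 / r * (r / 2)) with 1 by (field; lra); apply Cpow_1_l. }
    set (p := (RtoC (2 / r) ^ k)%C) in *; set (q := (RtoC (r / 2) ^ k)%C) in *.
    rewrite <- (@scal_one _ X (c k)) at 1.
    change (@one C_AbsRing) with (RtoC 1); rewrite <- Ek; module_ring. }
  rewrite E; apply Rle_trans with (1 := norm_scal_C _ _).
  rewrite Cmod_pow, Cmod_R, Rabs_pos_eq, Rmult_comm
    by (apply Rlt_le, Rdiv_lt_0_compat; lra).
  apply Rmult_le_compat_r; [apply pow_le, Rlt_le, Rdiv_lt_0_compat; lra|apply HB]. }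
destruct Hc as (B & B0 & HB).
assert (E0 : h z0 = c O).
{ apply is_series_unique_C with (u := fun k => scal (RtoC 0 ^ k)%C (c k)).
  - replace z0 with (z0 + RtoC 0)%C at 1 by ring; apply H'; rewrite Cmod_0; lra.
  - assert (P := is_pseries_0 c).
    apply is_series_ext with (2 := P); intros k; f_equal; apply pow_n_Cpow. }
exists (c 1%nat), (2 * B * (2 / r) ^ 2), (r / 4); split; [lra|].
assert (q0 : 0 < 2 / r) by (apply Rdiv_lt_0_compat; lra).
split; [apply Rmult_le_pos; [lra|apply pow2_ge_0]|].
intros z Hz; set (w := (z - z0)%C) in *.
replace (h z) with (h (z0 + w)%C) by (f_equal; unfold w; ring).
rewrite E0; clear E0.
assert (w0 := Cmod_ge_0 w).
set (q := Cmod w * (2 / r)).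
assert (hq : 0 <= q <= / 2).
{ unfold q; split; [apply Rmult_le_pos; lra|].
  apply Rmult_le_reg_r with r; [lra|].
  replace (Cmod w * (2 / r) * r) with (2 * Cmod w) by (field; lra); lra. }
replace (2 * B * (2 / r) ^ 2 * Cmod w ^ 2) with (2 * B * q ^ 2)
  by (unfold q; ring).
replace (minus (minus _ _) _) with
  (minus (h (z0 + w)%C) (plus (c O) (scal w (c 1%nat)))) by module_ring.
apply is_series_norm_minus_le with (1 := H' w ltac:(lra)) (N0 := 1%nat).
(* The factor [2 (1 - 2^(-N))] is the geometric partial sum; the induction needs it in this exact
   form, and it is bounded by 2 only afterwards. *)
assert (G : forall N, norm (minus (sum_n (fun k => scal (w ^ k)%C (c k)) (S N))
  (plus (c O) (scal w (c 1%nat)))) <= 2 * B * q ^ 2 * (1 - (/ 2) ^ N)).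
{ induction N as [|N IH].
  - rewrite sum_Sn, sum_O.
    replace (minus _ _) with (@zero X).
    + rewrite (@norm_zero _ X); simpl; lra.
    + simpl; module_ring.
  - rewrite sum_Sn.
    set (y := sum_n _ (S N)) in *.
    replace (minus _ _) with (plus (minus y (plus (c O) (scal w (c 1%nat))))
      (scal (w ^ S (S N))%C (c (S (S N))))) by module_ring.
    apply Rle_trans with (1 := @norm_triangle C_AbsRing X _ _).
    assert (T : norm (scal (w ^ S (S N))%C (c (S (S N)))) <= B * (q ^ 2 * (/ 2) ^ N)).
    { apply Rle_trans with (1 := norm_scal_C _ _); rewrite Cmod_pow.
      apply Rle_trans with (Cmod w ^ S (S N) * (B * (2 / r) ^ S (S N))).
      - apply Rmult_le_compat_l; [now apply pow_le|apply HB].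
      - replace (Cmod w ^ S (S N) * (B * (2 / r) ^ S (S N))) with (B * q ^ S (S N))
          by (unfold q; rewrite Rpow_mult_distr; ring).
        apply Rmult_le_compat_l; [lra|].
        replace (q ^ S (S N)) with (q ^ 2 * q ^ N) by (simpl; ring).
        apply Rmult_le_compat_l; [apply pow2_ge_0|].
        apply pow_incr; lra. }
    replace ((/ 2) ^ S N) with (/ 2 * (/ 2) ^ N) by reflexivity.
    lra. }
intros [|N] HN; [lia|].
apply Rle_trans with (1 := G N).
assert (0 <= 2 * B * q ^ 2) by (apply Rmult_le_pos; [lra|apply pow2_ge_0]).
assert (0 <= (/ 2) ^ N) by (apply pow_le; lra).
nra.
Qed.
End series.

(** * The complex exponential *)

Lemma Cmod_Cexp (z : C) : Cmod (Cexp z) = exp (Re z).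
Proof.
unfold Cmod, Cexp; simpl.
replace (_ + _) with (exp (Re z) * exp (Re z) * ((sin (Im z))² + (cos (Im z))²))
  by (unfold Rsqr; ring).
rewrite sin2_cos2, Rmult_1_r; apply sqrt_square, Rlt_le, exp_pos.
Qed.

Lemma Cexp_plus (z w : C) : Cexp (z + w)%C = (Cexp z * Cexp w)%C.
Proof.
unfold Cexp, Cmult; rewrite re_plus, im_plus; cbn [fst snd].
rewrite exp_plus, cos_plus, sin_plus; f_equal; ring.
Qed.

Lemma Cexp_RtoC (x : R) : Cexp (RtoC x) = RtoC (exp x).
Proof. unfold Cexp, RtoC; simpl; rewrite cos_0, sin_0; f_equal; ring. Qed.

Lemma Cexp_0 : Cexp (RtoC 0) = RtoC 1.
Proof. now rewrite Cexp_RtoC, exp_0. Qed.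

Lemma Cexp_opp (z : C) : Cexp (- z)%C = (/ Cexp z)%C.
Proof.
assert (H : Cexp z <> 0%C) by (apply Cmod_gt_0; rewrite Cmod_Cexp; apply exp_pos).
assert (E : (Cexp (- z) * Cexp z)%C = RtoC 1)
  by (rewrite <- Cexp_plus; replace (- z + z)%C with (RtoC 0) by ring; apply Cexp_0).
replace (Cexp (- z))%C with (Cexp (- z) * Cexp z * / Cexp z)%C by (field; exact H).
rewrite E; ring.
Qed.

Definition Cexp_poly (N : nat) (w : C) : C :=
  sum_n (G := C_AbelianMonoid) (fun m => (RtoC (/ INR (fact m)) * w ^ m)%C) N.

Lemma is_derive_Re_Cexp (k w : C) (s : R) :
  is_derive (fun s : R => Re (k * Cexp (s * w))%C) s (Re (k * w * Cexp (s * w))%C).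
Proof.
destruct k as [k1 k2], w as [x y]; unfold Cexp; simpl.
auto_derive; [trivial|].
replace (s * y + 0 * x) with (s * y) by ring.
replace (s * x - 0 * y) with (s * x) by ring.
replace (s * x + - (0 * y)) with (s * x) by ring.
ring.
Qed.

(* Taylor's formula for the real functions [s -> Re (k e^(sw))]; taking for [k] the
   conjugate of the remainder yields the estimate in modulus. *)
Lemma Cexp_taylor (N : nat) (w : C) :
  Cmod (Cexp w - Cexp_poly N w)%C <= Cmod w ^ S N / INR (fact (S N)) * exp (Cmod w).
Proof.
set (d := (Cexp w - Cexp_poly N w)%C).
set (k := Cconj d).
set (g := fun s : R => Re (k * Cexp (s * w))%C).
assert (Dg : forall m s, Derive_n g m s = Re (k * w ^ m * Cexp (s * w))%C).
{ induction m as [|m IH]; intros s.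
  - change (Re (k * Cexp (s * w))%C = Re (k * w ^ 0 * Cexp (s * w))%C).
    f_equal; change (w ^ 0)%C with (RtoC 1); ring.
  - simpl Derive_n; rewrite (Derive_ext _ _ s IH).
    rewrite (is_derive_unique _ _ _ (is_derive_Re_Cexp (k * w ^ m) w s)).
    f_equal; rewrite Cpow_S; ring. }
destruct (Taylor_Lagrange g N 0 1 ltac:(lra)) as (zeta & Hz & E).
{ intros t _ [|m] _; simpl; [trivial|].
  apply ex_derive_ext with (fun s : R => Re (k * w ^ m * Cexp (s * w))%C).
  - intros s; symmetry; apply Dg.
  - eexists; apply is_derive_Re_Cexp. }
assert (E1 : g 1 = Re (k * Cexp w)%C) by (unfold g; do 3 f_equal; ring).
assert (E2 : forall n, sum_f_R0 (fun m => (1 - 0) ^ m / INR (fact m) * Derive_n g m 0) n =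
   Re (k * Cexp_poly n w)%C).
{ clearbody k; unfold Cexp_poly; induction n as [|n IH].
  - rewrite sum_O; change (sum_f_R0 _ 0) with ((1 - 0) ^ 0 / INR (fact 0) * Derive_n g 0 0).
    rewrite Dg; replace (RtoC 0 * w)%C with (RtoC 0) by ring; rewrite Cexp_0.
    change (INR (fact 0)) with 1; rewrite Rinv_1, !Cmult_1_l.
    change (w ^ 0)%C with (RtoC 1); rewrite !Cmult_1_r; simpl; field.
  - rewrite sum_Sn, tech5, IH, Dg.
    replace (RtoC 0 * w)%C with (RtoC 0) by ring; rewrite Cexp_0.
    change plus with Cplus.
    rewrite Cmult_plus_distr_l, re_plus; f_equal.
    rewrite Rminus_0_r, pow1.
    set (c := / INR (fact (S n))); unfold Rdiv; fold c; rewrite Rmult_1_l.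
    replace (k * (c * w ^ S n))%C with (RtoC c * (k * w ^ S n * RtoC 1))%C by ring.
    rewrite re_scal_l; reflexivity. }
assert (E3 : Cmod d ^ 2 = (1 - 0) ^ S N / INR (fact (S N)) * Derive_n g (S N) zeta).
{ apply RtoC_inj; rewrite Cmod2_conj; fold k.
  assert (Ed : Re (d * k)%C = (1 - 0) ^ S N / INR (fact (S N)) * Derive_n g (S N) zeta).
  { rewrite Cmult_comm; unfold d at 1; unfold Cminus.
    rewrite Cmult_plus_distr_l, re_plus, <- E1, E, E2.
    replace (k * - Cexp_poly N w)%C with (- (k * Cexp_poly N w))%C by ring.
    rewrite re_opp; ring. }
  rewrite <- Ed; unfold k; destruct d as [x y]; unfold Cconj, Cmult, RtoC; simpl.
  f_equal; ring. }
rewrite Dg, Rminus_0_r, pow1 in E3.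
assert (f0 := INR_fact_lt_0 (S N)).
assert (B : Re (k * w ^ S N * Cexp (zeta * w))%C <= Cmod d * (Cmod w ^ S N * exp (Cmod w))).
{ apply Rle_trans with (1 := Rle_abs _), Rle_trans with (1 := re_le_Cmod _).
  rewrite !Cmod_mult, Cmod_pow, Cmod_Cexp; unfold k; rewrite Cmod_conj, Rmult_assoc.
  apply Rmult_le_compat_l; [apply Cmod_ge_0|].
  apply Rmult_le_compat_l; [apply pow_le, Cmod_ge_0|].
  assert (h1 := Rle_trans _ _ _ (Rle_abs _) (re_le_Cmod w)).
  assert (h2 := Cmod_ge_0 w).
  rewrite re_scal_l.
  destruct (Rle_lt_or_eq_dec (zeta * Re w) (Cmod w)) as [h|h]; [nra| |].
  - now apply Rlt_le, exp_increasing.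
  - rewrite h; lra. }
destruct (Rle_lt_or_eq_dec 0 (Cmod d) (Cmod_ge_0 d)) as [d0|d0].
- apply Rmult_le_reg_l with (1 := d0).
  replace (Cmod d * Cmod d) with (Cmod d ^ 2) by ring; rewrite E3.
  apply Rle_trans with (/ INR (fact (S N)) * (Cmod d * (Cmod w ^ S N * exp (Cmod w)))).
  + unfold Rdiv; rewrite Rmult_1_l; apply Rmult_le_compat_l; [|exact B].
    now apply Rlt_le, Rinv_0_lt_compat.
  + apply Req_le; field; lra.
- rewrite <- d0; apply Rmult_le_pos; [|apply Rlt_le, exp_pos].
  apply Rmult_le_pos; [apply pow_le, Cmod_ge_0|].
  now apply Rlt_le, Rinv_0_lt_compat.
Qed.

(** Once [e^(z0 u)] is factored out, this is the first-order Taylor estimate at [w u]; the radius 1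
    lets [e^(|w u|)] be replaced by the constant [e^|u|]. *)
Lemma holo_at_Cexp_scal (u : R) (z0 : C) :
  holo_at (X := C_NormedModule) (fun z => Cexp (z * RtoC u)%C) z0.
Proof.
exists (Cexp (z0 * RtoC u) * RtoC u)%C, (exp (Re (z0 * RtoC u)%C) * (u ^ 2 * exp (Rabs u))), 1.
split; [lra|].
split.
{ apply Rmult_le_pos; [apply Rlt_le, exp_pos|].
  apply Rmult_le_pos; [apply pow2_ge_0|apply Rlt_le, exp_pos]. }
intros z Hz; set (w := (z - z0)%C) in *.
change (Cmod ((Cexp (z * u) - Cexp (z0 * u)) - w * (Cexp (z0 * u) * u))%C <=
  exp (Re (z0 * u)%C) * (u ^ 2 * exp (Rabs u)) * Cmod w ^ 2).
replace (z * u)%C with (z0 * u + w * u)%C by (unfold w; ring).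
rewrite Cexp_plus.
assert (T := Cexp_taylor 1 (w * u)%C).
replace (Cexp_poly 1 (w * u)) with (1 + w * u)%C in T.
2:{ unfold Cexp_poly; rewrite sum_Sn, sum_O; simpl.
    change plus with Cplus; rewrite Rinv_1; ring. }
replace (_ - _ - _)%C with (Cexp (z0 * u) * (Cexp (w * u) - (1 + w * u)))%C by ring.
rewrite Cmod_mult, Cmod_Cexp, !Rmult_assoc.
apply Rmult_le_compat_l; [apply Rlt_le, exp_pos|].
apply Rle_trans with (1 := T); rewrite !Cmod_mult, Cmod_R.
replace ((Cmod w * Rabs u) ^ 2) with (u ^ 2 * Cmod w ^ 2)
  by (rewrite <- (pow2_abs u); ring).
assert (w0 := Cmod_ge_0 w); assert (u0 := Rabs_pos u).
assert (e1 : exp (Cmod w * Rabs u) <= exp (Rabs u)).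
{ destruct (Rle_lt_or_eq_dec (Cmod w * Rabs u) (Rabs u)) as [h|h]; [nra| |].
  - now apply Rlt_le, exp_increasing.
  - rewrite h; lra. }
assert (e2 := exp_pos (Cmod w * Rabs u)).
assert (p1 : 0 <= u ^ 2 * Cmod w ^ 2) by (apply Rmult_le_pos; apply pow2_ge_0).
change (INR (fact 2)) with (1 + 1).
apply Rle_trans with (u ^ 2 * Cmod w ^ 2 * exp (Rabs u)); [|apply Req_le; ring].
apply Rmult_le_compat; [|lra| |lra].
- apply Rmult_le_pos; lra.
- lra.
Qed.

(** * Cauchy's theorem on rectangles *)

Lemma Cmod_Ci : Cmod Ci = 1.
Proof.
unfold Cmod, Ci; simpl.
replace (_ + _) with 1 by ring; apply sqrt_1.
Qed.

Section integral.
Context {X : CompleteNormedModule C_AbsRing}.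

Definition XInt (f : R -> X) (a b : R) : X := RInt (V := restr X) f a b.

Definition cont_on (f : R -> X) (a b : R) : Prop :=
  forall x, a <= x <= b -> continuous (U := restr X) f x.

Lemma ex_XInt (f : R -> X) (a b : R) :
  a <= b -> cont_on f a b -> ex_RInt (V := restr X) f a b.
Proof.
intros ab H; apply ex_RInt_continuous.
rewrite Rmin_left, Rmax_right by exact ab; exact H.
Qed.

Lemma XInt_Chasles (f : R -> X) (a b c : R) : a <= b -> b <= c -> cont_on f a c ->
  XInt f a c = plus (XInt f a b) (XInt f b c).
Proof.
intros ab bc H; symmetry.
apply (RInt_Chasles (V := restr X)); apply ex_XInt; try assumption;
  intros x Hx; apply H; lra.
Qed.

Lemma XInt_minus (f g : R -> X) (a b : R) : a <= b -> cont_on f a b -> cont_on g a b ->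
  XInt (fun x => minus (f x) (g x)) a b = minus (XInt f a b) (XInt g a b).
Proof.
intros ab Hf Hg; apply (RInt_minus (V := restr X)); now apply ex_XInt.
Qed.

Lemma XInt_ext (f g : R -> X) (a b : R) : a <= b ->
  (forall x, a <= x <= b -> f x = g x) -> XInt f a b = XInt g a b.
Proof.
intros ab H; apply (RInt_ext (V := restr X)); intros x Hx.
rewrite Rmin_left, Rmax_right in Hx by exact ab; apply H; lra.
Qed.

Lemma XInt_norm_le (f : R -> X) (a b B : R) : a <= b -> cont_on f a b ->
  (forall x, a <= x <= b -> norm (f x) <= B) -> norm (XInt f a b) <= (b - a) * B.
Proof.
intros ab Hf HB.
exact (norm_RInt_le_const (V := restr X) f a b _ B ab HB
  (RInt_correct (V := restr X) f a b (ex_XInt f a b ab Hf))).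
Qed.

Lemma XInt_scal_derive (P p : R -> R) (v : X) (a b : R) :
  (forall x, is_derive P x (p x)) -> (forall x, continuous p x) ->
  is_RInt (V := restr X) (fun x => scal (RtoC (p x)) v : X) a b
    (scal (RtoC (P b - P a)) v).
Proof.
intros HP Hp.
assert (H := is_RInt_derive (V := restr X) (fun x => scal (P x) (v : restr X))
  (fun x => scal (p x) (v : restr X)) a b).
replace (scal (RtoC (P b - P a)) v) with
  (minus (scal (RtoC (P b)) v) (scal (RtoC (P a)) v))
  by (rewrite RtoC_minus; module_ring).
apply H; intros x _.
- apply (is_derive_scal_l (V := restr X)), HP.
- apply (continuous_scal_l (V := restr X)), Hp.
Qed.

Lemma XInt_affine (u v : X) (x0 a b : R) :
  XInt (fun x => plus (scal (RtoC (x - x0)) u) v) a b =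
  plus (scal (RtoC ((b - x0) ^ 2 / 2 - (a - x0) ^ 2 / 2)) u) (scal (RtoC (b - a)) v).
Proof.
apply (is_RInt_unique (V := restr X)).
apply (is_RInt_plus (V := restr X)).
- apply (XInt_scal_derive (fun x => (x - x0) ^ 2 / 2) (fun x => x - x0)).
  + intros x; auto_derive; [trivial|field].
  + intros x; apply (continuous_minus (V := R_NormedModule)).
    * apply continuous_id.
    * apply continuous_const.
- exact (is_RInt_const (V := restr X) a b v).
Qed.

(** Splitting [(p + i q) v] as [p v + q (i v)] reduces the claim to real scalars, where [RInt p a x]
    serves as primitive. It turns the vector integral of [v / z] into four real integrals per kind
    of side in [rect_inv]. *)
Lemma XInt_scal_l (p q : R -> R) (v : X) (a b : R) :
  (forall x, continuous p x) -> (forall x, continuous q x) ->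
  XInt (fun x => scal ((p x, q x) : C) v) a b =
  scal ((RInt p a b, RInt q a b) : C) v.
Proof.
intros Hp Hq.
assert (K : forall (r : R -> R) u, (forall x, continuous r x) ->
  is_RInt (V := restr X) (fun x => scal (RtoC (r x)) u : X) a b (scal (RtoC (RInt r a b)) u)).
{ intros r u Hr.
  assert (H := XInt_scal_derive (fun x => RInt r a x) r u a b).
  replace (RInt r a b) with (RInt r a b - RInt r a a)
    by (rewrite RInt_point; apply Rminus_0_r).
  apply H; [intros x|exact Hr].
  apply is_derive_RInt with a; [|apply Hr].
  exists (mkposreal 1 Rlt_0_1); intros y _.
  apply (RInt_correct (V := R_CompleteNormedModule)).
  apply (ex_RInt_continuous (V := R_CompleteNormedModule)); intros; apply Hr. }
assert (E : forall s t : R, scal ((s, t) : C) v =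
  plus (scal (RtoC s) v) (scal (RtoC t) (scal Ci v))).
{ intros s t; module_coefs.
  unfold Ci, RtoC, Cmult, Cplus; simpl; f_equal; ring. }
rewrite E; apply (is_RInt_unique (V := restr X)).
apply (is_RInt_ext (V := restr X)) with
  (fun x => plus (scal (RtoC (p x)) v) (scal (RtoC (q x)) (scal Ci v))).
{ intros x _; symmetry; apply E. }
apply (is_RInt_plus (V := restr X)); now apply K.
Qed.

Lemma holo_at_continuous_curve (h : C -> X) (g : R -> C) (x0 : R) :
  (forall x, Cmod (g x - g x0)%C = Rabs (x - x0)) ->
  holo_at h (g x0) -> continuous (U := restr X) (fun x => h (g x)) x0.
Proof.
intros Hg Hh.
destruct (holo_at_lipschitz h _ Hh) as (L & r & r0 & L0 & H).
apply (filterlim_locally (U := restr X)); intros eps.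
assert (d0 : 0 < Rmin r (eps / (L + 1))).
{ apply Rmin_glb_lt; [exact r0|].
  apply Rdiv_lt_0_compat; [apply cond_pos|lra]. }
exists (mkposreal _ d0); intros x Hx.
change (Rabs (x - x0) < Rmin r (eps / (L + 1))) in Hx.
apply (norm_compat1 (V := X)).
assert (h1 := Rlt_le_trans _ _ _ Hx (Rmin_l _ _)).
assert (h2 := Rlt_le_trans _ _ _ Hx (Rmin_r _ _)).
rewrite <- Hg in h1; specialize (H _ h1); rewrite Hg in H.
apply Rle_lt_trans with (1 := H).
assert (h3 := Rabs_pos (x - x0)); assert (h4 := cond_pos eps).
apply Rle_lt_trans with ((L + 1) * Rabs (x - x0)); [nra|].
replace (pos eps) with ((L + 1) * (eps / (L + 1))) by (field; lra).
apply Rmult_lt_compat_l; lra.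
Qed.

Lemma Cmod_horizontal (x x0 y : R) : Cmod ((x, y) - (x0, y))%C = Rabs (x - x0).
Proof.
replace ((x, y) - (x0, y))%C with (RtoC (x - x0)); [apply Cmod_R|].
unfold RtoC, Cminus, Cplus, Copp; simpl; f_equal; ring.
Qed.

Lemma Cmod_vertical (x y y0 : R) : Cmod ((x, y) - (x, y0))%C = Rabs (y - y0).
Proof.
replace ((x, y) - (x, y0))%C with (Ci * RtoC (y - y0))%C.
- rewrite Cmod_mult, Cmod_R.
  rewrite Cmod_Ci; ring.
- unfold RtoC, Ci, Cminus, Cplus, Copp, Cmult; simpl; f_equal; ring.
Qed.

Definition hint (h : C -> X) (y a b : R) : X := XInt (fun x => h (x, y)) a b.
Definition vint (h : C -> X) (x c d : R) : X := XInt (fun y => scal Ci (h (x, y))) c d.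

(* Counterclockwise integral along the boundary of [a,b] x [c,d]. *)
Definition rect (h : C -> X) (a b c d : R) : X :=
  minus (minus (plus (hint h c a b) (vint h b c d)) (hint h d a b)) (vint h a c d).

Definition holo_on (a b c d : R) (h : C -> X) : Prop :=
  forall x y, a <= x <= b -> c <= y <= d -> holo_at h (x, y).

Definition boundary (a b c d x y : R) : Prop :=
  a <= x <= b /\ c <= y <= d /\ (x = a \/ x = b \/ y = c \/ y = d).

Definition holo_on_boundary (a b c d : R) (h : C -> X) : Prop :=
  forall x y, boundary a b c d x y -> holo_at h (x, y).

Lemma holo_on_boundary_sub (a b c d : R) (h : C -> X) :
  holo_on a b c d h -> holo_on_boundary a b c d h.
Proof. intros H x y B; apply H; apply B. Qed.

Lemma cont_hint (h : C -> X) (y a b : R) :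
  (forall x, a <= x <= b -> holo_at h (x, y)) -> cont_on (fun x => h (x, y)) a b.
Proof.
intros H x Hx; apply (holo_at_continuous_curve h (fun x => (x, y))).
- intros x'; apply Cmod_horizontal.
- now apply H.
Qed.

Lemma cont_vint (h : C -> X) (x c d : R) :
  (forall y, c <= y <= d -> holo_at h (x, y)) -> cont_on (fun y => scal Ci (h (x, y))) c d.
Proof.
intros H y Hy.
apply (holo_at_continuous_curve (fun z => scal Ci (h z)) (fun y => (x, y))).
- intros y'; apply Cmod_vertical.
- exact (holo_at_scal_const Ci h _ (H y Hy)).
Qed.

(** The two integrals over the cut at [m] cancel as opposite terms; the hypotheses on [h] serve to
    cut the two horizontal integrals. *)
Lemma rect_split_x (h : C -> X) (a m b c d : R) : a <= m <= b -> c <= d ->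
  (forall x, a <= x <= b -> holo_at h (x, c)) ->
  (forall x, a <= x <= b -> holo_at h (x, d)) ->
  rect h a b c d = plus (rect h a m c d) (rect h m b c d).
Proof.
intros Hm cd Hc Hd; unfold rect, hint.
rewrite (XInt_Chasles (fun x => h (x, c)) a m b), (XInt_Chasles (fun x => h (x, d)) a m b);
  try lra; try (now apply cont_hint).
module_ring.
Qed.

Lemma rect_split_y (h : C -> X) (a b c m d : R) : a <= b -> c <= m <= d ->
  (forall y, c <= y <= d -> holo_at h (a, y)) ->
  (forall y, c <= y <= d -> holo_at h (b, y)) ->
  rect h a b c d = plus (rect h a b c m) (rect h a b m d).
Proof.
intros ab Hm Ha Hb; unfold rect, vint.
rewrite (XInt_Chasles (fun y => scal Ci (h (a, y))) c m d),
  (XInt_Chasles (fun y => scal Ci (h (b, y))) c m d);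
  try lra; try (now apply cont_vint).
module_ring.
Qed.

Lemma rect_minus (h g : C -> X) (a b c d : R) : a <= b -> c <= d ->
  holo_on_boundary a b c d h -> holo_on_boundary a b c d g ->
  rect (fun z => minus (h z) (g z)) a b c d = minus (rect h a b c d) (rect g a b c d).
Proof.
intros ab cd Hh Hg; unfold rect, hint, vint.
rewrite !(XInt_minus (fun x => h (x, _)) (fun x => g (x, _))) by
  (try lra; apply cont_hint; intros; try apply Hh; try apply Hg; unfold boundary; lra).
assert (E : forall x, XInt (fun y => scal Ci (minus (h (x, y)) (g (x, y)))) c d =
   XInt (fun y => minus (scal Ci (h (x, y))) (scal Ci (g (x, y)))) c d).
{ intros x; apply XInt_ext; [exact cd|intros; module_ring]. }
rewrite !E.
rewrite !(XInt_minus (fun y => scal Ci (h (_, y))) (fun y => scal Ci (g (_, y)))) by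
  (try lra; apply cont_vint; intros; try apply Hh; try apply Hg; unfold boundary; lra).
module_ring.
Qed.

Lemma norm_scal_Ci (v : X) : norm (scal Ci v) <= norm v.
Proof.
apply Rle_trans with (1 := @norm_scal_C X _ _); apply Req_le.
rewrite Cmod_Ci; ring.
Qed.

Lemma hint_norm_le (h : C -> X) (y a b B : R) : a <= b ->
  (forall x, a <= x <= b -> holo_at h (x, y)) ->
  (forall x, a <= x <= b -> norm (h (x, y)) <= B) -> norm (hint h y a b) <= (b - a) * B.
Proof. intros ab H HB; apply XInt_norm_le; auto; now apply cont_hint. Qed.

Lemma vint_norm_le (h : C -> X) (x c d B : R) : c <= d ->
  (forall y, c <= y <= d -> holo_at h (x, y)) ->
  (forall y, c <= y <= d -> norm (h (x, y)) <= B) -> norm (vint h x c d) <= (d - c) * B.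
Proof.
intros cd H HB; apply XInt_norm_le; auto; [now apply cont_vint|].
intros y Hy; apply Rle_trans with (1 := norm_scal_Ci _); now apply HB.
Qed.

Lemma rect_norm_le (h : C -> X) (a b c d B : R) : a <= b -> c <= d ->
  holo_on_boundary a b c d h ->
  (forall x y, boundary a b c d x y -> norm (h (x, y)) <= B) ->
  norm (rect h a b c d) <= 2 * ((b - a) + (d - c)) * B.
Proof.
intros ab cd Hh HB; unfold rect.
apply Rle_trans with (1 := @norm_minus_le X _ _).
apply Rle_trans with (1 := Rplus_le_compat_r _ _ _ (@norm_minus_le X _ _)).
apply Rle_trans with
  (1 := Rplus_le_compat_r _ _ _ (Rplus_le_compat_r _ _ _ (@norm_triangle C_AbsRing X _ _))).
assert (h1 : norm (hint h c a b) <= (b - a) * B)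
  by (apply hint_norm_le; [exact ab| |]; intros;
    [apply Hh|apply HB]; unfold boundary; lra).
assert (h2 : norm (hint h d a b) <= (b - a) * B)
  by (apply hint_norm_le; [exact ab| |]; intros;
    [apply Hh|apply HB]; unfold boundary; lra).
assert (h3 : norm (vint h a c d) <= (d - c) * B)
  by (apply vint_norm_le; [exact cd| |]; intros;
    [apply Hh|apply HB]; unfold boundary; lra).
assert (h4 : norm (vint h b c d) <= (d - c) * B)
  by (apply vint_norm_le; [exact cd| |]; intros;
    [apply Hh|apply HB]; unfold boundary; lra).
lra.
Qed.

Definition affine (z0 : C) (v l : X) (z : C) : X := plus v (scal (z - z0)%C l).

Lemma holo_at_affine (z0 : C) (v l : X) (z : C) : holo_at (affine z0 v l) z.
Proof.
apply (holo_at_plus (X := X) (fun _ => v) (fun z => scal (z - z0)%C l));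
  [apply (@holo_at_const X)|].
apply (holo_at_scal (X := X) (fun z => z - z0)%C (fun _ => l)); [|apply (@holo_at_const X)].
apply (holo_at_minus (X := C_NormedModule) (fun z => z) (fun _ => z0)).
- apply holo_at_id.
- apply (@holo_at_const C_NormedModule).
Qed.

(** Explicit integration. In Goursat's argument this disposes of the first-order part of [h],
    leaving only the quadratic remainder to be estimated. *)
Lemma rect_affine (z0 : C) (v l : X) (a b c d : R) : a <= b -> c <= d ->
  rect (affine z0 v l) a b c d = zero.
Proof.
intros ab cd; unfold rect, hint, vint, affine; destruct z0 as [x0 y0].
assert (Eh : forall y, XInt (fun x => plus v (scal ((x, y) - (x0, y0))%C l)) a b =
  XInt (fun x => plus (scal (RtoC (x - x0)) l) (plus v (scal (Ci * RtoC (y - y0))%C l))) a b).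
{ intros y; apply XInt_ext; [exact ab|intros x _].
  replace ((x, y) - (x0, y0))%C with (RtoC (x - x0) + Ci * RtoC (y - y0))%C
    by (unfold RtoC, Ci, Cminus, Cplus, Copp, Cmult; simpl; f_equal; ring).
  module_ring. }
assert (Ev : forall x, XInt (fun y => scal Ci (plus v (scal ((x, y) - (x0, y0))%C l))) c d =
  XInt (fun y => plus (scal (RtoC (y - y0)) (scal (Ci * Ci)%C l))
    (scal Ci (plus v (scal (RtoC (x - x0)) l)))) c d).
{ intros x; apply XInt_ext; [exact cd|intros y _].
  replace ((x, y) - (x0, y0))%C with (RtoC (x - x0) + Ci * RtoC (y - y0))%C
    by (unfold RtoC, Ci, Cminus, Cplus, Copp, Cmult; simpl; f_equal; ring).
  module_ring. }
rewrite !Eh, !Ev, !XInt_affine.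
module_coefs; unfold RtoC, Ci, Cminus, Cplus, Copp, Cmult; simpl; f_equal; field.
Qed.

(** Every left endpoint lies below every right endpoint, so the supremum of the left endpoints
    belongs to all the intervals. *)
Lemma nested_intervals (a b : nat -> R) :
  (forall n, a n <= a (S n)) -> (forall n, b (S n) <= b n) -> (forall n, a n <= b n) ->
  exists x, forall n, a n <= x <= b n.
Proof.
intros Ha Hb Hab.
assert (Ha' : forall n k, a n <= a (k + n)%nat)
  by (intros n; induction k as [|k IH]; [simpl; lra|];
      apply Rle_trans with (1 := IH), Ha).
assert (Hb' : forall n k, b (k + n)%nat <= b n)
  by (intros n; induction k as [|k IH]; [simpl; lra|];
      apply Rle_trans with (2 := IH), Hb).
assert (U : forall m n, a m <= b n).
{ intros m n; apply Rle_trans with (1 := Ha' m n).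
  apply Rle_trans with (1 := Hab _); rewrite PeanoNat.Nat.add_comm; apply Hb'. }
destruct (completeness (fun r => exists n, r = a n)) as [x [Hx1 Hx2]].
- exists (b O); intros r [n ->]; apply U.
- exists (a O); now exists O.
- exists x; intros n; split; [apply Hx1; now exists n|].
  apply Hx2; intros r [m ->]; apply U.
Qed.

Lemma half_pow_lt (B eps : R) : 0 < eps -> exists n, B * (/ 2) ^ n < eps.
Proof.
intros He.
destruct (pow_lt_1_zero (/ 2) ltac:(rewrite Rabs_pos_eq; lra) (eps / (Rabs B + 1)))
  as [n Hn].
{ apply Rdiv_lt_0_compat; [exact He|]; assert (h := Rabs_pos B); lra. }
exists n; specialize (Hn n ltac:(lia)).
assert (p0 : 0 < (/ 2) ^ n) by (apply pow_lt; lra).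
rewrite Rabs_pos_eq in Hn by lra.
assert (h := Rabs_pos B); assert (h1 := Rle_abs B).
apply Rle_lt_trans with ((Rabs B + 1) * (/ 2) ^ n); [nra|].
replace eps with ((Rabs B + 1) * (eps / (Rabs B + 1))) by (field; lra).
apply Rmult_lt_compat_l; lra.
Qed.

(* Goursat: bisection yields nested rectangles [Q n] on whose boundary the integral has norm at
   least [4^(-n)] times the original one, while the quadratic remainder makes it [O(8^(-n))]. *)
Lemma rect_holo_zero (h : C -> X) (a b c d : R) : a <= b -> c <= d ->
  holo_on a b c d h -> rect h a b c d = zero.
Proof.
intros ab cd Hh.
set (bad := fun (n : nat) (q : (R * R) * (R * R)) =>
  norm (rect h a b c d) <= 4 ^ n * norm (rect h (fst (fst q)) (snd (fst q))
    (fst (snd q)) (snd (snd q)))).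
set (sub := fun q : (R * R) * (R * R) =>
  a <= fst (fst q) /\ fst (fst q) <= snd (fst q) /\ snd (fst q) <= b /\
  c <= fst (snd q) /\ fst (snd q) <= snd (snd q) /\ snd (snd q) <= d).
set (lo := fun i : R * R => (fst i, (fst i + snd i) / 2)).
set (hi := fun i : R * R => ((fst i + snd i) / 2, snd i)).
set (half := fun i j : R * R => j = lo i \/ j = hi i).
(* A sigma type rather than an existential: [Rle_dec] selects a quarter, and the sequence of
   rectangles becomes a plain recursion on pairs of a rectangle and its invariants. *)
assert (step : forall n q, sub q -> bad n q ->
  {q' | half (fst q) (fst q') /\ half (snd q) (snd q') /\ bad (S n) q'}).
{ intros n [i j] Hs Hb.
  assert (dec : forall q', {bad (S n) q'} + {~ bad (S n) q'})
    by (intros q'; apply Rle_dec).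
  destruct (dec (lo i, lo j)) as [h1|h1];
    [exists (lo i, lo j); unfold half; simpl; auto|].
  destruct (dec (lo i, hi j)) as [h2|h2];
    [exists (lo i, hi j); unfold half; simpl; auto|].
  destruct (dec (hi i, lo j)) as [h3|h3];
    [exists (hi i, lo j); unfold half; simpl; auto|].
  destruct (dec (hi i, hi j)) as [h4|h4];
    [exists (hi i, hi j); unfold half; simpl; auto|].
  exfalso.
  destruct i as [a' b'], j as [c' d']; unfold sub, bad, lo, hi in *; simpl in *.
  apply Rnot_le_lt in h1; apply Rnot_le_lt in h2.
  apply Rnot_le_lt in h3; apply Rnot_le_lt in h4.
  rewrite (rect_split_x h a' ((a' + b') / 2) b') in Hb
    by (try lra; intros; apply Hh; lra).
  rewrite (rect_split_y h a' _ c' ((c' + d') / 2) d') in Hb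
    by (try lra; intros; apply Hh; lra).
  rewrite (rect_split_y h _ b' c' ((c' + d') / 2) d') in Hb
    by (try lra; intros; apply Hh; lra).
  assert (t1 := @norm_triangle C_AbsRing X
    (plus (rect h a' ((a' + b') / 2) c' ((c' + d') / 2))
          (rect h a' ((a' + b') / 2) ((c' + d') / 2) d'))
    (plus (rect h ((a' + b') / 2) b' c' ((c' + d') / 2))
          (rect h ((a' + b') / 2) b' ((c' + d') / 2) d'))).
  assert (t2 := @norm_triangle C_AbsRing X
    (rect h a' ((a' + b') / 2) c' ((c' + d') / 2))
    (rect h a' ((a' + b') / 2) ((c' + d') / 2) d')).
  assert (t3 := @norm_triangle C_AbsRing X
    (rect h ((a' + b') / 2) b' c' ((c' + d') / 2))
    (rect h ((a' + b') / 2) b' ((c' + d') / 2) d')).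
  assert (p : 0 < 4 ^ n) by (apply pow_lt; lra).
  assert (t4 := Rle_trans _ _ _ t1 (Rplus_le_compat _ _ _ _ t2 t3)).
  assert (t5 := Rle_trans _ _ _ Hb (Rmult_le_compat_l _ _ _ (Rlt_le _ _ p) t4)).
  lra. }
assert (half_sub : forall q q', sub q -> half (fst q) (fst q') ->
  half (snd q) (snd q') -> sub q').
{ intros [[a1 b1] [c1 d1]] [[a2 b2] [c2 d2]]; unfold sub, half, lo, hi; simpl.
  intros S [E|E] [E'|E']; injection E as -> ->; injection E' as -> ->; lra. }
set (T := fun n => {q | sub q /\ bad n q}).
assert (Hq0 : sub ((a, b), (c, d)) /\ bad O ((a, b), (c, d))).
{ unfold sub, bad; simpl; split; [lra|].
  rewrite Rmult_1_l; apply Rle_refl. }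
set (q0 := exist _ ((a, b), (c, d)) Hq0 : T O).
set (next := fun n (t : T n) =>
  let (q, H) := t in
  let (q', H') := step n q (proj1 H) (proj2 H) in
  exist (fun q => sub q /\ bad (S n) q) q'
    (conj (half_sub q q' (proj1 H) (proj1 H') (proj1 (proj2 H'))) (proj2 (proj2 H')))
  : T (S n)).
assert (next_half : forall n t, half (fst (proj1_sig t)) (fst (proj1_sig (next n t))) /\
  half (snd (proj1_sig t)) (snd (proj1_sig (next n t)))).
{ intros n [q H]; unfold next; simpl.
  destruct (step n q (proj1 H) (proj2 H)) as [q' H']; simpl; tauto. }
set (qs := fix qs n : T n := match n with O => q0 | S n => next n (qs n) end).
set (Q := fun n => proj1_sig (qs n)).
assert (QH : forall n, half (fst (Q n)) (fst (Q (S n))) /\ half (snd (Q n)) (snd (Q (S n))))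
  by (intros n; exact (next_half n (qs n))).
assert (QS : forall n, sub (Q n)) by (intros n; exact (proj1 (proj2_sig (qs n)))).
assert (QB : forall n, bad n (Q n)) by (intros n; exact (proj2 (proj2_sig (qs n)))).
assert (Hhalf : forall i j, fst i <= snd i -> half i j ->
  fst i <= fst j /\ snd j <= snd i /\ snd j - fst j = (snd i - fst i) / 2).
{ intros [u v] [u' v'] Hi [E|E]; unfold lo, hi in E; simpl in *; injection E as -> ->; lra. }
destruct (nested_intervals (fun n => fst (fst (Q n))) (fun n => snd (fst (Q n)))) as [x0 Hx0].
{ intros n; apply Hhalf; [apply (QS n)|apply QH]. }
{ intros n; apply Hhalf; [apply (QS n)|apply QH]. }
{ intros n; apply (QS n). }
destruct (nested_intervals (fun n => fst (snd (Q n))) (fun n => snd (snd (Q n)))) as [y0 Hy0].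
{ intros n; apply Hhalf; [apply (QS n)|apply QH]. }
{ intros n; apply Hhalf; [apply (QS n)|apply QH]. }
{ intros n; apply (QS n). }
assert (Qlen : forall n, snd (fst (Q n)) - fst (fst (Q n)) + (snd (snd (Q n)) - fst (snd (Q n))) =
  ((b - a) + (d - c)) * (/ 2) ^ n).
{ induction n as [|n IH].
  - change (b - a + (d - c) = (b - a + (d - c)) * 1); ring.
  - assert (h1 := Hhalf _ _ (proj1 (proj2 (QS n))) (proj1 (QH n))).
    assert (h2 := Hhalf _ _ (proj1 (proj2 (proj2 (proj2 (proj2 (QS n)))))) (proj2 (QH n))).
    replace ((/ 2) ^ S n) with (/ 2 * (/ 2) ^ n) by reflexivity; lra. }
destruct (Hh x0 y0) as (l & A & r & r0 & A0 & H).
{ assert (h1 := Hx0 O); assert (h2 := QS O); unfold sub in h2; simpl in h1; lra. }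
{ assert (h1 := Hy0 O); assert (h2 := QS O); unfold sub in h2; simpl in h1; lra. }
set (L := (b - a) + (d - c)) in *.
assert (L0 : 0 <= L) by (unfold L; lra).
apply (@norm_eq_zero C_AbsRing X).
apply Rle_antisym; [|apply norm_ge_0].
apply le_epsilon; intros eps Heps; rewrite Rplus_0_l.
(* [n1] brings the rectangle into the disc where the expansion at [(x0, y0)] holds, [n2] makes the
   final bound smaller than [eps]. *)
destruct (half_pow_lt L r r0) as [n1 Hn1].
destruct (half_pow_lt (2 * A * L ^ 3) eps Heps) as [n2 Hn2].
set (n := (n1 + n2)%nat).
assert (P1 : (/ 2) ^ n <= (/ 2) ^ n1).
{ unfold n; rewrite pow_add.
  assert (0 < (/ 2) ^ n1) by (apply pow_lt; lra).
  assert ((/ 2) ^ n2 <= 1) by (rewrite <- (pow1 n2); apply pow_incr; lra).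
  nra. }
assert (P2 : (/ 2) ^ n <= (/ 2) ^ n2).
{ unfold n; rewrite pow_add.
  assert (0 < (/ 2) ^ n2) by (apply pow_lt; lra).
  assert ((/ 2) ^ n1 <= 1) by (rewrite <- (pow1 n1); apply pow_incr; lra).
  nra. }
apply Rle_trans with (1 := QB n).
assert (Hl := Qlen n); assert (Hs := QS n); assert (Hx := Hx0 n); assert (Hy := Hy0 n).
destruct (Q n) as [[a' b'] [c' d']]; unfold sub in Hs; cbn [fst snd] in *.
set (e := (/ 2) ^ n) in *.
assert (e0 : 0 < e) by (apply pow_lt; lra).
assert (Hsub : holo_on a' b' c' d' h) by (intros x y hx hy; apply Hh; lra).
replace (rect h a' b' c' d') with
  (rect (fun z => minus (h z) (affine (x0, y0) (h (x0, y0)) l z)) a' b' c' d').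
2:{ rewrite rect_minus; try lra.
    - rewrite rect_affine by lra; module_ring.
    - now apply holo_on_boundary_sub.
    - intros x y _; apply holo_at_affine. }
assert (K : norm (rect (fun z => minus (h z) (affine (x0, y0) (h (x0, y0)) l z)) a' b' c' d')
  <= 2 * ((b' - a') + (d' - c')) * (A * (L * e) ^ 2)).
{ apply rect_norm_le; try lra.
  - intros x y (hx & hy & _).
    apply (holo_at_minus (X := X) h (affine (x0, y0) (h (x0, y0)) l)).
    + now apply Hsub.
    + apply holo_at_affine.
  - intros x y (hx & hy & _); unfold affine.
    assert (D : Cmod ((x, y) - (x0, y0))%C <= L * e).
    { replace ((x, y) - (x0, y0))%C with (((x, y) - (x0, y)) + ((x0, y) - (x0, y0)))%C by ring.
      apply Rle_trans with (1 := Cmod_triangle _ _).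
      rewrite Cmod_horizontal, Cmod_vertical, <- Hl.
      apply Rplus_le_compat; apply Rabs_le; lra. }
    assert (D0 := Cmod_ge_0 ((x, y) - (x0, y0))%C).
    replace (minus _ _) with (minus (minus (h (x, y)) (h (x0, y0)))
      (scal ((x, y) - (x0, y0))%C l)) by module_ring.
    apply Rle_trans with (A * Cmod ((x, y) - (x0, y0))%C ^ 2).
    + apply H; apply Rle_lt_trans with (1 := D).
      apply Rle_lt_trans with (2 := Hn1); apply Rmult_le_compat_l; assumption.
    + apply Rmult_le_compat_l; [exact A0|]; apply pow_incr; lra. }
rewrite Hl in K.
apply Rle_trans with (4 ^ n * (2 * (L * e) * (A * (L * e) ^ 2))).
{ apply Rmult_le_compat_l; [apply pow_le; lra|exact K]. }
(* Perimeter and squared diameter supply three factors [e = 2^(-n)]; two of them absorb [4^n] and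
   the third tends to 0. *)
replace (4 ^ n * (2 * (L * e) * (A * (L * e) ^ 2))) with
  (2 * A * L ^ 3 * e * (4 ^ n * (e * e))) by ring.
replace (4 ^ n * (e * e)) with 1.
2:{ unfold e; rewrite <- Rpow_mult_distr, <- Rpow_mult_distr.
    replace (4 * (/ 2 * / 2)) with 1 by field; symmetry; apply pow1. }
apply Rlt_le; rewrite Rmult_1_r; apply Rle_lt_trans with (2 := Hn2).
apply Rmult_le_compat_l; [|exact P2].
apply Rmult_le_pos; [lra|apply pow_le; exact L0].
Qed.
End integral.

(** * The value at the origin and the boundary integral *)

Section residue.
Context {X : CompleteNormedModule C_AbsRing}.

Lemma pair_neq_0 (x y : R) : x <> 0 \/ y <> 0 -> ((x, y) : C) <> RtoC 0.
Proof. intros H E; injection E as -> ->; lra. Qed.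

Lemma holo_at_inv_scal (h : C -> X) (z : C) : z <> RtoC 0 ->
  holo_at h z -> holo_at (fun z => scal (/ z)%C (h z)) z.
Proof.
intros Hz Hh; apply (holo_at_scal (X := X) (fun z => / z)%C h); [|exact Hh].
now apply holo_at_inv.
Qed.

(** The difference quotient is bounded by a Lipschitz constant [L] near 0. Cutting out a square of
    half-side [e] around 0 leaves four rectangles on which Goursat applies, and the square
    contributes at most [8 e L]. *)
Lemma rect_removable (h : C -> X) (a b c d : R) : a < 0 < b -> c < 0 < d ->
  holo_on a b c d h ->
  rect (fun z => scal (/ z)%C (minus (h z) (h (RtoC 0)))) a b c d = zero.
Proof.
intros Ha Hc Hh.
set (g := fun z => scal (/ z)%C (minus (h z) (h (RtoC 0)))).
assert (Hg : forall x y, a <= x <= b -> c <= y <= d -> x <> 0 \/ y <> 0 -> holo_at g (x, y)).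
{ intros x y hx hy h0; apply holo_at_inv_scal; [now apply pair_neq_0|].
  apply (holo_at_minus (X := X) h (fun _ => h (RtoC 0))); [now apply Hh|].
  apply (@holo_at_const X). }
destruct (holo_at_lipschitz h (RtoC 0)) as (L & r & r0 & L0 & HL).
{ apply (Hh 0 0); lra. }
apply (@norm_eq_zero C_AbsRing X), Rle_antisym; [|apply norm_ge_0].
apply le_epsilon; intros eps Heps; rewrite Rplus_0_l.
set (m := Rmin (Rmin (- a) b) (Rmin (- c) d)).
assert (m0 : 0 < m) by (unfold m; repeat apply Rmin_glb_lt; lra).
assert (m1 : m <= - a /\ m <= b /\ m <= - c /\ m <= d).
{ assert (h1 := Rmin_l (Rmin (- a) b) (Rmin (- c) d)).
  assert (h2 := Rmin_r (Rmin (- a) b) (Rmin (- c) d)); fold m in h1, h2.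
  assert (h3 := Rmin_l (- a) b); assert (h4 := Rmin_r (- a) b).
  assert (h5 := Rmin_l (- c) d); assert (h6 := Rmin_r (- c) d); lra. }
(* [m / 2] keeps the square inside the rectangle, [r / 4] keeps it in the disc of the Lipschitz
   bound, and the last entry makes [8 e L] at most [eps]; [L + 1] avoids a division by zero. *)
set (e := Rmin (m / 2) (Rmin (r / 4) (eps / (8 * (L + 1))))).
assert (e0 : 0 < e).
{ unfold e; repeat apply Rmin_glb_lt; try lra; apply Rdiv_lt_0_compat; lra. }
assert (e1 : e <= m / 2) by apply Rmin_l.
assert (e2 : e <= r / 4) by (eapply Rle_trans; [apply Rmin_r|apply Rmin_l]).
assert (e3 : e <= eps / (8 * (L + 1))) by (eapply Rle_trans; [apply Rmin_r|apply Rmin_r]).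
clearbody e.
rewrite (rect_split_x g a (- e) b c d) by (try lra; intros; apply Hg; lra).
rewrite (rect_split_x g (- e) e b c d) by (try lra; intros; apply Hg; lra).
rewrite (rect_split_y g (- e) e c (- e) d) by (try lra; intros; apply Hg; lra).
rewrite (rect_split_y g (- e) e (- e) e d) by (try lra; intros; apply Hg; lra).
rewrite (rect_holo_zero g a (- e) c d), (rect_holo_zero g e b c d),
  (rect_holo_zero g (- e) e c (- e)), (rect_holo_zero g (- e) e e d)
  by (try lra; intros x y hx hy; apply Hg; lra).
replace (plus _ _) with (rect g (- e) e (- e) e) by module_ring.
apply Rle_trans with (2 * ((e - - e) + (e - - e)) * L).
- apply rect_norm_le; try lra.
  + intros x y (hx & hy & hb); apply Hg; lra.
  + intros x y (hx & hy & hb); unfold g.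
    assert (h0 : (x, y) <> RtoC 0) by (apply pair_neq_0; lra).
    apply Rle_trans with (1 := @norm_scal_C X _ _).
    assert (c0 := Cmod_gt_0 (x, y)); destruct c0 as [c0 _]; specialize (c0 h0).
    rewrite Cmod_inv by exact h0.
    assert (B : norm (minus (h (x, y)) (h (RtoC 0))) <= L * Cmod (x, y)).
    { replace ((x, y) : C) with ((x, y) - 0)%C at 2 by ring; apply HL.
      replace ((x, y) - 0)%C with ((RtoC x) + Ci * RtoC y)%C
        by (unfold RtoC, Ci, Cminus, Cplus, Copp, Cmult; simpl; f_equal; ring).
      apply Rle_lt_trans with (1 := Cmod_triangle _ _).
      rewrite Cmod_mult, Cmod_Ci, !Cmod_R.
      assert (Rabs x <= e) by (apply Rabs_le; lra).
      assert (Rabs y <= e) by (apply Rabs_le; lra).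
      lra. }
    apply Rle_trans with (/ Cmod (x, y) * (L * Cmod (x, y))).
    * apply Rmult_le_compat_l; [|exact B]; now apply Rlt_le, Rinv_0_lt_compat.
    * apply Req_le; field; lra.
- assert (E : eps = 8 * (L + 1) * (eps / (8 * (L + 1)))) by (field; lra).
  rewrite E; apply Rle_trans with (8 * (L + 1) * e); [nra|].
  apply Rmult_le_compat_l; lra.
Qed.

Lemma Cinv_pair (x y : R) :
  (/ (x, y))%C = (x / (x ^ 2 + y ^ 2), - y / (x ^ 2 + y ^ 2)).
Proof. unfold Cinv; simpl; reflexivity. Qed.

Lemma RInt_nonneg_div (y k a b : R) : a <= b -> y <> 0 -> 0 <= k ->
  0 <= RInt (fun x => k / (x ^ 2 + y ^ 2)) a b.
Proof.
intros ab hy hk; apply RInt_ge_0; [exact ab| |].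
- apply (ex_RInt_continuous (V := R_CompleteNormedModule)); intros x _.
  apply (ex_derive_continuous (V := R_NormedModule)); auto_derive; nra.
- intros x _; apply Rmult_le_pos; [exact hk|].
  apply Rlt_le, Rinv_0_lt_compat; nra.
Qed.

Lemma RInt_ext_R (f g : R -> R) (a b : R) : (forall x, f x = g x) ->
  RInt f a b = RInt g a b.
Proof. intros H; apply RInt_ext; intros x _; apply H. Qed.

(** The imaginary part of [dz / z] is the increment of the angle, which is nonnegative along each
    side of a rectangle around 0. The right side alone gives 1, since [T / (y^2 + T^2) >= 1 / (2T)]
    over a length [2T]; no arctangent has to be evaluated. *)
Lemma rect_inv (v : X) (a T : R) : a < 0 < T ->
  exists J : C, 1 <= Im J /\
    rect (fun z => scal (/ z)%C v) a T (- T) T = scal J v.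
Proof.
intros Ha.
assert (Hc : forall p q y : R, y <> 0 -> forall x,
  continuous (fun x : R => (p * x + q) / (x ^ 2 + y ^ 2)) x).
{ intros p q y hy x; apply (ex_derive_continuous (V := R_NormedModule)).
  auto_derive; nra. }
assert (Eh : forall y, y <> 0 -> hint (fun z => scal (/ z)%C v) y a T =
  scal ((RInt (fun x => (1 * x + 0) / (x ^ 2 + y ^ 2)) a T,
         RInt (fun x => (0 * x + - y) / (x ^ 2 + y ^ 2)) a T) : C) v).
{ intros y hy; rewrite <- XInt_scal_l by (apply Hc; exact hy).
  unfold hint; apply XInt_ext; [lra|intros x _].
  rewrite Cinv_pair; do 2 f_equal; f_equal; ring. }
assert (Ev : forall x, x <> 0 -> vint (fun z => scal (/ z)%C v) x (- T) T =
  scal ((RInt (fun y => (1 * y + 0) / (y ^ 2 + x ^ 2)) (- T) T,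
         RInt (fun y => (0 * y + x) / (y ^ 2 + x ^ 2)) (- T) T) : C) v).
{ intros x hx; rewrite <- XInt_scal_l by (apply Hc; exact hx).
  unfold vint; apply XInt_ext; [lra|intros y _].
  rewrite Cinv_pair.
  replace (scal Ci (scal _ v)) with
    (scal (Ci * (x / (x ^ 2 + y ^ 2), - y / (x ^ 2 + y ^ 2))%R)%C v) by module_ring.
  f_equal; unfold Ci, Cmult; simpl.
  f_equal; field; nra. }
unfold rect; rewrite !Eh, !Ev by lra.
set (h1 := RInt (fun x => (1 * x + 0) / _) a T).
set (v1 := RInt (fun y => (1 * y + 0) / (y ^ 2 + T ^ 2)) _ _).
set (h2 := RInt (fun x => (1 * x + 0) / (x ^ 2 + T ^ 2)) a T).
set (v2 := RInt (fun y => (1 * y + 0) / _) (- T) T).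
set (i1 := RInt (fun x => (0 * x + - - T) / _) a T).
set (i2 := RInt (fun y => (0 * y + T) / _) _ _).
set (i3 := RInt (fun x => (0 * x + - T) / _) a T).
set (i4 := RInt (fun y => (0 * y + a) / _) _ _).
exists ((h1, i1) + (v1, i2) - (h2, i3) - (v2, i4))%C; split; [|module_ring].
assert (K1 : 0 <= i1).
{ unfold i1; rewrite (RInt_ext_R _ (fun x => T / (x ^ 2 + (- T) ^ 2))).
  - apply RInt_nonneg_div; lra.
  - intros x; f_equal; ring. }
assert (K3 : 0 <= - i3).
{ unfold i3; rewrite <- (RInt_opp (V := R_CompleteNormedModule)).
  - rewrite (RInt_ext_R _ (fun x => T / (x ^ 2 + T ^ 2))).
    + apply RInt_nonneg_div; lra.
    + intros x; change opp with Ropp; field; nra.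
  - apply (ex_RInt_continuous (V := R_CompleteNormedModule)); intros x _.
    apply Hc; lra. }
assert (K4 : 0 <= - i4).
{ unfold i4; rewrite <- (RInt_opp (V := R_CompleteNormedModule)).
  - rewrite (RInt_ext_R _ (fun x => - a / (x ^ 2 + a ^ 2))).
    + apply RInt_nonneg_div; lra.
    + intros x; change opp with Ropp; field; nra.
  - apply (ex_RInt_continuous (V := R_CompleteNormedModule)); intros x _.
    apply Hc; lra. }
assert (K2 : 1 <= i2).
{ replace 1 with (RInt (fun _ : R => / (2 * T)) (- T) T).
  - unfold i2; apply RInt_le; try lra.
    + apply ex_RInt_const.
    + apply (ex_RInt_continuous (V := R_CompleteNormedModule)); intros x _.
      apply Hc; lra.
    + intros x hx.
      replace (/ (2 * T)) with (T * / (2 * T ^ 2)) by (field; lra).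
      unfold Rdiv; rewrite Rmult_0_l, Rplus_0_l.
      apply Rmult_le_compat_l; [lra|].
      apply Rinv_le_contravar; nra.
  - rewrite RInt_const; change (@eq R ((T - - T) * / (2 * T)) 1); field; lra. }
simpl; lra.
Qed.

(* Cauchy's formula gives an equality up to the factor [2 i pi]; here only [1 <= Im J] is used. *)
Lemma rect_cauchy (h : C -> X) (a T : R) : a < 0 < T ->
  holo_on a T (- T) T h ->
  norm (h (RtoC 0)) <= norm (rect (fun z => scal (/ z)%C (h z)) a T (- T) T).
Proof.
intros Ha Hh.
destruct (rect_inv (h (RtoC 0)) a T Ha) as (J & HJ & EJ).
assert (E : rect (fun z => scal (/ z)%C (h z)) a T (- T) T = scal J (h (RtoC 0))).
{ assert (R0 := rect_removable h a T (- T) T Ha ltac:(lra) Hh).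
  rewrite <- EJ.
  set (p := rect (fun z => scal (/ z)%C (h z)) a T (- T) T).
  set (q := rect (fun z => scal (/ z)%C (h (RtoC 0))) a T (- T) T).
  replace p with (plus (minus p q) q) by module_ring.
  unfold p, q; rewrite <- rect_minus.
  - replace (rect _ a T (- T) T) with
      (rect (fun z => scal (/ z)%C (minus (h z) (h (RtoC 0)))) a T (- T) T) at 1.
    + rewrite R0; module_ring.
    + unfold rect, hint, vint.
      f_equal; [f_equal; [f_equal|]|]; apply XInt_ext; try lra; intros; module_ring.
  - lra.
  - lra.
  - intros x y (hx & hy & hb); apply holo_at_inv_scal; [apply pair_neq_0; lra|].
    now apply Hh.
  - intros x y (hx & hy & hb); apply holo_at_inv_scal; [apply pair_neq_0; lra|].
    apply (@holo_at_const X). }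
rewrite E.
assert (J1 : 1 <= Cmod J).
{ apply Rle_trans with (1 := HJ), Rle_trans with (1 := Rle_abs _).
  apply Rle_trans with (2 := Rmax_Cmod J), Rmax_r. }
assert (J0 : J <> 0%C) by (apply Cmod_gt_0; lra).
replace (h (RtoC 0)) with (scal (/ J)%C (scal J (h (RtoC 0)))) at 1.
- apply Rle_trans with (1 := @norm_scal_C X _ _); rewrite Cmod_inv by exact J0.
  rewrite <- (Rmult_1_l (norm _)) at 2.
  apply Rmult_le_compat_r; [apply norm_ge_0|].
  rewrite <- Rinv_1; apply Rinv_le_contravar; lra.
- module_coefs; field; exact J0.
Qed.
End residue.

(** * Dirichlet series *)

Lemma exp_le (x y : R) : x <= y -> exp x <= exp y.
Proof. intros [h|h]; [now apply Rlt_le, exp_increasing|rewrite h; lra]. Qed.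

(** The tangent at [s v] gives [e^v >= e^(sv) (1 + (1 - s) v)] and [1 >= e^(sv) (1 - s v)]; with the
    weights [s] and [1 - s] the linear terms cancel. *)
Lemma exp_convex (s v : R) : 0 <= s <= 1 -> exp (s * v) <= 1 - s + s * exp v.
Proof.
intros Hs.
assert (h1 := exp_ineq1_le ((1 - s) * v)); assert (h2 := exp_ineq1_le (- (s * v))).
assert (e0 := exp_pos (s * v)).
assert (E1 : exp v = exp (s * v) * exp ((1 - s) * v)) by (rewrite <- exp_plus; f_equal; ring).
assert (E2 : 1 = exp (s * v) * exp (- (s * v)))
  by (rewrite <- exp_plus, <- exp_0; f_equal; ring).
assert (k1 : exp (s * v) * (1 + (1 - s) * v) <= exp v)
  by (rewrite E1; apply Rmult_le_compat_l; lra).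
assert (k2 : exp (s * v) * (1 + - (s * v)) <= 1)
  by (rewrite E2 at 2; apply Rmult_le_compat_l; lra).
assert (k3 := Rmult_le_compat_l s _ _ (proj1 Hs) k1).
assert (k4 := Rmult_le_compat_l (1 - s) _ _ ltac:(lra) k2).
lra.
Qed.

(* [(k + 1) ^ s] *)
Definition npow (k : nat) (s : R) : R := exp (s * ln (INR (S k))).

Lemma INR_S_pos (k : nat) : 0 < INR (S k).
Proof. apply lt_0_INR; lia. Qed.

Lemma npow_pos (k : nat) (s : R) : 0 < npow k s.
Proof. apply exp_pos. Qed.

Lemma npow_plus (k : nat) (s r : R) : npow k (s + r) = npow k s * npow k r.
Proof. unfold npow; rewrite <- exp_plus; f_equal; ring. Qed.

Lemma npow_m1 (k : nat) : npow k (- 1) = / INR (S k).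
Proof.
unfold npow; replace (- 1 * ln (INR (S k))) with (- ln (INR (S k))) by ring.
rewrite exp_Ropp, exp_ln; [reflexivity|apply INR_S_pos].
Qed.

Lemma ln_INR_S_nonneg (k : nat) : 0 <= ln (INR (S k)).
Proof.
rewrite <- ln_1; apply ln_le; [lra|].
rewrite S_INR; assert (h := pos_INR k); lra.
Qed.

Lemma ln_INR_S_le (k : nat) : ln (INR (S k)) <= ln (INR (S (S k))).
Proof. apply ln_le; [apply INR_S_pos|rewrite (S_INR (S k)); lra]. Qed.

Lemma npow_0_l (s : R) : npow 0 s = 1.
Proof. unfold npow; simpl; rewrite ln_1, Rmult_0_r; apply exp_0. Qed.

Lemma npow_ratio (k : nat) (s : R) :
  npow k s = npow (S k) s * exp (s * (ln (INR (S k)) - ln (INR (S (S k))))).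
Proof. unfold npow; rewrite <- exp_plus; f_equal; ring. Qed.

Lemma exp_ln_step (k : nat) :
  exp (ln (INR (S k)) - ln (INR (S (S k)))) = 1 - npow (S k) (- 1).
Proof.
rewrite npow_m1; unfold Rminus at 1; rewrite exp_plus, exp_Ropp, !exp_ln by apply INR_S_pos.
rewrite (S_INR (S k)); field; assert (h := INR_S_pos k); lra.
Qed.

Lemma exp_ln_step' (k : nat) :
  exp (ln (INR (S (S k))) - ln (INR (S k))) = 1 + npow k (- 1).
Proof.
rewrite npow_m1; unfold Rminus at 1; rewrite exp_plus, exp_Ropp, !exp_ln by apply INR_S_pos.
rewrite (S_INR (S k)); field; assert (h := INR_S_pos k); lra.
Qed.

(** Discrete form of comparing [n^(-1-s)], [n = k + 2], with the integral of [x^(-1-s)] over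
    [[n - 1, n]]: it amounts to [(1 - 1/n)^(-s) >= 1 + s/n]. Unlike an integral test it stays inside
    a telescoping sum. *)
Lemma npow_step_neg (k : nat) (s : R) : 0 < s ->
  npow (S k) (- (1 + s)) <= / s * (npow k (- s) - npow (S k) (- s)).
Proof.
intros s0; set (u := ln (INR (S k)) - ln (INR (S (S k)))).
assert (hu : u <= - npow (S k) (- 1)).
{ assert (h := exp_ineq1_le u); assert (h' := exp_ln_step k); fold u in h'; lra. }
assert (E : npow k (- s) = npow (S k) (- s) * exp (- s * u)) by apply npow_ratio.
assert (p := npow_pos (S k) (- s)).
assert (h := exp_ineq1_le (- s * u)).
replace (- (1 + s)) with (- s + - 1) by ring; rewrite npow_plus.
apply Rmult_le_reg_l with s; [exact s0|].
rewrite <- (Rmult_assoc s (/ s)), Rinv_r, Rmult_1_l by lra; rewrite E.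
assert (k1 : 1 + s * npow (S k) (- 1) <= exp (- s * u)) by nra.
assert (k2 := Rmult_le_compat_l _ _ _ (Rlt_le _ _ p) k1).
lra.
Qed.

(** Here [x^(s-1)] does not increase, so the right endpoint [n = k + 2] is the one controlled by the
    integral; the inequality is Bernoulli's [(1 - 1/n)^s <= 1 - s/n]. *)
Lemma npow_step_small (k : nat) (s : R) : 0 < s <= 1 ->
  npow (S k) (s - 1) <= / s * (npow (S k) s - npow k s).
Proof.
intros Hs.
assert (E := npow_ratio k s).
assert (h := exp_convex s (ln (INR (S k)) - ln (INR (S (S k)))) ltac:(lra)).
rewrite exp_ln_step in h.
assert (p := npow_pos (S k) s).
replace (s - 1) with (s + - 1) by ring; rewrite npow_plus.
apply Rmult_le_reg_l with s; [lra|].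
rewrite <- (Rmult_assoc s (/ s)), Rinv_r, Rmult_1_l by lra; rewrite E.
assert (k2 := Rmult_le_compat_l _ _ _ (Rlt_le _ _ p) h).
lra.
Qed.

(** Here [x^(s-1)] does not decrease, so only the left endpoint [n = k + 1] is controlled; the
    inequality is [(1 + 1/n)^s >= 1 + s/n], obtained from convexity with weight [1/s]. *)
Lemma npow_step_large (k : nat) (s : R) : 1 <= s ->
  npow k (s - 1) <= / s * (npow (S k) s - npow k s).
Proof.
intros Hs.
set (u := ln (INR (S (S k))) - ln (INR (S k))).
assert (E : npow (S k) s = npow k s * exp (s * u))
  by (unfold npow, u; rewrite <- exp_plus; f_equal; ring).
assert (h := exp_convex (/ s) (s * u)).
replace (/ s * (s * u)) with u in h by (field; lra).
assert (hu := exp_ln_step' k); fold u in hu; rewrite hu in h.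
assert (i0 : 0 < / s) by (apply Rinv_0_lt_compat; lra).
specialize (h ltac:(split; [lra|rewrite <- Rinv_1; apply Rinv_le_contravar; lra])).
assert (p := npow_pos k s).
replace (s - 1) with (s + - 1) by ring; rewrite npow_plus, E.
assert (k1 : npow k (- 1) <= / s * (exp (s * u) - 1)) by lra.
assert (k2 := Rmult_le_compat_l _ _ _ (Rlt_le _ _ p) k1).
lra.
Qed.

(** Size of the sums cut at [log n = t], relative to [e^(-st)] for the tail and [e^(st)] for the
    head: [1/s] comes from the integral, [e^(-t)] from the term next to the cut. *)
Definition dirichlet_bound (t s : R) : R := / s + exp (- t).

Lemma dirichlet_bound_pos (t s : R) : 0 < s -> 0 < dirichlet_bound t s.
Proof.
intros s0; unfold dirichlet_bound; assert (h := exp_pos (- t)).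
assert (0 < / s) by now apply Rinv_0_lt_compat.
lra.
Qed.

(** Telescoping of [npow_step_neg]: past the cut, the partial sum plus the reserve
    [(K + 1)^(-s) / s] never exceeds [E]. The first term past the cut has no predecessor to
    telescope with and is paid for by [e^(-t)]. *)
Lemma sum_npow_tail (t s : R) (K : nat) : 0 < s ->
  sum_n (fun k => if Rlt_dec (ln (INR (S k))) t then 0 else npow k (- (1 + s))) K <=
  exp (- (s * t)) * dirichlet_bound t s.
Proof.
intros s0.
assert (i0 : 0 < / s) by now apply Rinv_0_lt_compat.
set (E := exp (- (s * t)) * dirichlet_bound t s).
assert (E0 : 0 < E) by (apply Rmult_lt_0_compat; [apply exp_pos|now apply dirichlet_bound_pos]).
assert (entry : forall k, ~ ln (INR (S k)) < t ->
  npow k (- (1 + s)) <= E - / s * npow k (- s)).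
{ intros k h; apply Rnot_lt_le in h.
  assert (h1 : npow k (- s) <= exp (- (s * t))) by (apply exp_le; nra).
  assert (h2 : npow k (- (1 + s)) <= exp (- (s * t)) * exp (- t))
    by (rewrite <- exp_plus; apply exp_le; nra).
  assert (h3 := Rmult_le_compat_l _ _ _ (Rlt_le _ _ i0) h1).
  unfold E, dirichlet_bound; lra. }
set (U := sum_n _).
assert (G : (ln (INR (S K)) < t -> U K = 0) /\
  (~ ln (INR (S K)) < t -> U K <= E - / s * npow K (- s))).
{ induction K as [|K [IH1 IH2]]; unfold U; [rewrite sum_O|rewrite sum_Sn; fold U].
  - destruct (Rlt_dec (ln (INR 1)) t) as [h|h]; [tauto|].
    split; [tauto|]; intros _; now apply entry.
  - change plus with Rplus.
    destruct (Rlt_dec (ln (INR (S (S K)))) t) as [h|h].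
    + split; [intros _|tauto]; rewrite IH1; [apply Rplus_0_r|].
      apply Rle_lt_trans with (1 := ln_INR_S_le K), h.
    + split; [tauto|intros _].
      destruct (Rlt_dec (ln (INR (S K))) t) as [h'|h'].
      * rewrite IH1, Rplus_0_l by exact h'; now apply entry.
      * specialize (IH2 h'); assert (h1 := npow_step_neg K s s0); lra. }
destruct (Rlt_dec (ln (INR (S K))) t) as [h|h].
- rewrite (proj1 G h); lra.
- apply Rle_trans with (1 := proj2 G h); assert (p := npow_pos K (- s)).
  assert (0 <= / s * npow K (- s)) by (apply Rmult_le_pos; lra); lra.
Qed.

(** A potential [p] that grows at least as fast as the sum dominates it up to the cut; past the cut
    the sum stays constant. The cases [s < 1] and [s >= 1] differ only in the potential. *)
Lemma sum_npow_head_potential (t s E : R) (p : nat -> R) (K : nat) :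
  0 <= E -> 1 <= p O -> (forall k, p k + npow (S k) (s - 1) <= p (S k)) ->
  (forall k, ln (INR (S k)) < t -> p k <= E) ->
  sum_n (fun k => if Rlt_dec (ln (INR (S k))) t then npow k (s - 1) else 0) K <= E.
Proof.
intros E0 p0 ps pE.
set (U := sum_n _).
assert (G : U K <= E /\ (ln (INR (S K)) < t -> U K <= p K)).
{ induction K as [|K [IH1 IH2]]; unfold U; [rewrite sum_O|rewrite sum_Sn; fold U].
  - destruct (Rlt_dec (ln (INR 1)) t) as [h|h]; [|split; [exact E0|tauto]].
    rewrite npow_0_l; split; [|intros _; exact p0].
    apply Rle_trans with (1 := p0), pE, h.
  - change plus with Rplus.
    destruct (Rlt_dec (ln (INR (S (S K)))) t) as [h|h].
    + assert (h1 : U K <= p K) by (apply IH2, Rle_lt_trans with (1 := ln_INR_S_le K), h).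
      specialize (ps K); assert (h2 := pE _ h); lra.
    + rewrite Rplus_0_r; tauto. }
exact (proj1 G).
Qed.

Lemma sum_npow_head (t s : R) (K : nat) : 0 < s ->
  sum_n (fun k => if Rlt_dec (ln (INR (S k))) t then npow k (- (1 - s)) else 0) K <=
  exp (s * t) * dirichlet_bound t s.
Proof.
intros s0; replace (- (1 - s)) with (s - 1) by ring.
assert (i0 : 0 < / s) by now apply Rinv_0_lt_compat.
assert (E0 : 0 <= exp (s * t) * dirichlet_bound t s)
  by (apply Rlt_le, Rmult_lt_0_compat; [apply exp_pos|now apply dirichlet_bound_pos]).
assert (X : forall k, ln (INR (S k)) < t -> / s * npow k s <= / s * exp (s * t)).
{ intros k h; apply Rmult_le_compat_l; [lra|]; apply exp_le; nra. }
assert (Ep : exp (s * t) * dirichlet_bound t s = / s * exp (s * t) + exp (s * t) * exp (- t))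
  by (unfold dirichlet_bound; ring).
assert (e0 : 0 < exp (s * t) * exp (- t)) by (apply Rmult_lt_0_compat; apply exp_pos).
(* For [s >= 1] the step inequality bounds the previous term, so the potential carries the latest
   term as an extra summand, at most [e^(st) e^(-t)] before the cut. *)
destruct (Rle_lt_dec 1 s) as [h|h].
- apply sum_npow_head_potential with (fun k => / s * npow k s + npow k (s - 1)); [exact E0| | |].
  + rewrite !npow_0_l; lra.
  + intros k; assert (h1 := npow_step_large k s h); lra.
  + intros k hk; specialize (X k hk).
    assert (npow k (s - 1) <= exp (s * t) * exp (- t))
      by (rewrite <- exp_plus; apply exp_le; nra).
    lra.
- apply sum_npow_head_potential with (fun k => / s * npow k s); [exact E0| | |].
  + rewrite npow_0_l, Rmult_1_r, <- Rinv_1; apply Rinv_le_contravar; lra.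
  + intros k; assert (h1 := npow_step_small k s ltac:(lra)); lra.
  + intros k hk; specialize (X k hk); lra.
Qed.

(** This is the tail bound at [t = 0], where no index precedes the cut. *)
Lemma sum_npow_le (s : R) (K : nat) : 0 < s ->
  sum_n (fun k => npow k (- (1 + s))) K <= / s + 1.
Proof.
intros s0; assert (H := sum_npow_tail 0 s K s0).
unfold dirichlet_bound in H; rewrite Rmult_0_r, Ropp_0, exp_0, Rmult_1_l in H.
apply Rle_trans with (2 := H), Req_le, sum_n_ext; intros k.
destruct (Rlt_dec (ln (INR (S k))) 0) as [h|h]; [|reflexivity].
assert (h1 := ln_INR_S_nonneg k); lra.
Qed.

Lemma ex_series_npow (s : R) : 0 < s -> ex_series (fun k => npow k (- (1 + s))).
Proof.
intros s0.
destruct (ex_finite_lim_seq_incr (sum_n (fun k => npow k (- (1 + s)))) (/ s + 1)) as [l Hl].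
- intros n; rewrite sum_Sn; change plus with Rplus.
  assert (h := npow_pos (S n) (- (1 + s))); lra.
- intros n; now apply sum_npow_le.
- exists l; exact Hl.
Qed.

(** * The Dirichlet series, its partial sums and its analyticity *)

Section dirichlet.
Context {X : CompleteNormedModule C_AbsRing}.
Variables (b : nat -> X) (B : R).
Hypothesis B0 : 0 <= B.
Hypothesis Hb : forall n : nat, (1 <= n)%nat -> norm (b n) <= B.
Let a : nat -> X := fun n => scal (/ RtoC (INR n))%C (b n).
Let f : C -> X := dirichlet_series a.
Let term (z : C) (k : nat) : X := dirichlet_term a z (S k).

Lemma norm_term_le (z : C) (k : nat) : norm (term z k) <= B * npow k (- (1 + Re z)).
Proof.
unfold term, dirichlet_term, a, nat_Cpower.
assert (i0 := INR_S_pos k).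
apply Rle_trans with (1 := @norm_scal_C X _ _).
rewrite <- Cexp_opp, Cmod_Cexp.
replace (exp _) with (npow k (- Re z)).
2:{ unfold npow; rewrite re_opp, re_scal_r; f_equal; ring. }
replace (- (1 + Re z)) with (- Re z + - 1) by ring; rewrite npow_plus, npow_m1.
replace (B * (npow k (- Re z) * / INR (S k))) with (npow k (- Re z) * (/ INR (S k) * B)) by ring.
apply Rmult_le_compat_l; [apply Rlt_le, npow_pos|].
apply Rle_trans with (1 := @norm_scal_C X _ _).
assert (i1 : RtoC (INR (S k)) <> 0%C) by (intros E; apply RtoC_inj in E; lra).
rewrite Cmod_inv, Cmod_R, Rabs_pos_eq by (exact i1 || lra).
apply Rmult_le_compat_l; [now apply Rlt_le, Rinv_0_lt_compat|apply Hb; lia].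
Qed.

(** With base point 0 this displays a term as an exponential times a fixed vector; with base point
    [z0] it prepares the expansion of the series at [z0]. *)
Lemma term_shift (z w : C) (k : nat) :
  term (z + w)%C k = scal (Cexp (w * RtoC (- ln (INR (S k)))))%C (term z k).
Proof.
unfold term, dirichlet_term, nat_Cpower; rewrite <- !Cexp_opp.
replace (- ((z + w) * RtoC (ln (INR (S k)))))%C with
  (w * RtoC (- ln (INR (S k))) + - (z * RtoC (ln (INR (S k)))))%C
  by (rewrite RtoC_opp; ring).
rewrite Cexp_plus; module_ring.
Qed.

Lemma term_0 (k : nat) : term (RtoC 0) k = a (S k).
Proof.
unfold term, dirichlet_term, nat_Cpower.
replace (RtoC 0 * _)%C with (RtoC 0) by ring; rewrite Cexp_0.
module_coefs; field; intros E; apply RtoC_inj in E; lra.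
Qed.

Lemma holo_at_term (k : nat) (z : C) : holo_at (fun z => term z k) z.
Proof.
apply holo_at_ext with
  (fun z => scal (Cexp (z * RtoC (- ln (INR (S k))))%C) (a (S k))).
- intros z'; rewrite <- term_0, <- term_shift; f_equal; ring.
- apply (holo_at_scal (X := X) (fun z => Cexp (z * RtoC (- ln (INR (S k))))%C)
    (fun _ => a (S k))); [apply holo_at_Cexp_scal|apply (@holo_at_const X)].
Qed.

(** A multiplier may spend all of the decay [n^(- Re z)] but a power [n^(-s)]. With [p = 1] this is
    convergence of the series, with powers of [log n] that of its Taylor coefficients. *)
Lemma ex_series_scaled_term (z : C) (p : nat -> C) (P s : R) : 0 < s ->
  (forall k, Cmod (p k) <= P * npow k (Re z - s)) ->
  ex_series (fun k => scal (p k) (term z k) : X).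
Proof.
intros s0 Hp.
apply (ex_series_le (V := X)) with (fun k => scal (P * B) (npow k (- (1 + s))) : R).
- intros k; apply Rle_trans with (1 := @norm_scal_C X _ _).
  change (scal (P * B) (npow k (- (1 + s)))) with ((P * B) * npow k (- (1 + s))).
  replace (P * B * npow k (- (1 + s))) with
    (P * npow k (Re z - s) * (B * npow k (- (1 + Re z)))).
  + apply Rmult_le_compat; [apply Cmod_ge_0|apply norm_ge_0|apply Hp|apply norm_term_le].
  + replace (- (1 + s)) with (Re z - s + - (1 + Re z)) by ring.
    rewrite npow_plus; ring.
- apply (ex_series_scal (V := R_NormedModule)), ex_series_npow, s0.
Qed.

Lemma dirichlet_series_correct (z : C) : right_half_plane z -> is_series (term z) (f z).
Proof.
intros Hz.
assert (Ex : ex_series (term z)).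
{ apply ex_series_ext with (fun k => scal (RtoC 1) (term z k)).
  - intros k; exact (@scal_one C_Ring X _).
  - apply ex_series_scaled_term with 1 (Re z); [exact Hz|].
    intros k; rewrite Cmod_1, Rminus_diag; unfold npow.
    rewrite Rmult_0_l, exp_0; lra. }
destruct Ex as [l Hl].
apply (iota_correct (V := X) (is_series (term z))); exists l; split; [exact Hl|].
intros l' Hl'; exact (is_series_unique_C (X := X) _ _ _ Hl Hl').
Qed.

Definition head (t : R) (z : C) : X :=
  sum_n (fun k => if Rlt_dec (ln (INR (S k))) t then term z k else zero)
    (Z.to_nat (up (exp t))).

Lemma head_0 (t : R) : head t (RtoC 0) = sum_log_lt a t.
Proof.
unfold head, sum_log_lt; apply sum_n_ext; intros k.
destruct (Rlt_dec _ _); [apply term_0|reflexivity].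
Qed.

Lemma holo_at_head (t : R) (z : C) : holo_at (head t) z.
Proof.
apply (holo_at_sum_n (X := X)
  (fun k z => if Rlt_dec (ln (INR (S k))) t then term z k else zero)).
intros k; destruct (Rlt_dec _ _); [apply holo_at_term|apply (@holo_at_const X)].
Qed.

(** Every later index satisfies [n > exp t] and contributes zero. This lets [head] be compared with
    arbitrarily long partial sums of the series. *)
Lemma head_extend (t : R) (z : C) (K : nat) : (Z.to_nat (up (exp t)) <= K)%nat ->
  sum_n (fun k => if Rlt_dec (ln (INR (S k))) t then term z k else zero) K = head t z.
Proof.
intros HK; induction HK as [|K HK IH]; [reflexivity|].
rewrite sum_Sn, IH.
destruct (Rlt_dec _ _) as [h|h]; [exfalso|exact (plus_zero_r _)].
assert (h1 : INR (S (S K)) < exp t).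
{ rewrite <- (exp_ln (INR (S (S K)))) by apply INR_S_pos; now apply exp_increasing. }
assert (h2 := proj1 (archimed (exp t))).
assert (h3 : IZR (up (exp t)) <= INR (Z.to_nat (up (exp t)))).
{ rewrite INR_IZR_INZ; apply IZR_le; rewrite Znat.Z2Nat.id; [lia|].
  apply le_IZR; assert (h5 := exp_pos t); lra. }
assert (h4 : INR (Z.to_nat (up (exp t))) <= INR (S (S K))) by (apply le_INR; lia).
lra.
Qed.

Lemma norm_head_le (t s : R) (z : C) : 0 < s -> Re z = - s ->
  norm (head t z) <= B * (exp (s * t) * dirichlet_bound t s).
Proof.
intros s0 Hz.
apply Rle_trans with (B * sum_n (fun k => if Rlt_dec (ln (INR (S k))) t
  then npow k (- (1 - s)) else 0) (Z.to_nat (up (exp t)))).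
2:{ apply Rmult_le_compat_l; [exact B0|now apply sum_npow_head]. }
rewrite <- (sum_n_scal_l (K := R_Ring) (V := R_ModuleSpace)).
apply (norm_sum_n_le (X := X)); intros k _.
change (@scal R_Ring R_ModuleSpace B ?x) with (B * x).
destruct (Rlt_dec _ _).
- assert (h := norm_term_le z k); rewrite Hz in h; exact h.
- apply Rle_trans with 0; [apply Req_le, (@norm_zero C_AbsRing X)|lra].
Qed.

Lemma norm_tail_le (t s : R) (z : C) : 0 < s -> Re z = s ->
  norm (minus (f z) (head t z)) <= B * (exp (- (s * t)) * dirichlet_bound t s).
Proof.
intros s0 Hz.
apply (is_series_norm_minus_le (X := X)) with (term z) (Z.to_nat (up (exp t))).
{ apply dirichlet_series_correct; unfold right_half_plane; lra. }
intros K HK; rewrite <- (head_extend t z K HK).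
replace (minus _ _) with
  (sum_n (fun k => if Rlt_dec (ln (INR (S k))) t then zero else term z k) K).
2:{ clear HK; induction K as [|K IH]; rewrite ?sum_O, ?sum_Sn.
    - destruct (Rlt_dec _ _); module_ring.
    - rewrite IH; destruct (Rlt_dec _ _); module_ring. }
apply Rle_trans with (B * sum_n (fun k => if Rlt_dec (ln (INR (S k))) t
  then 0 else npow k (- (1 + s))) K).
2:{ apply Rmult_le_compat_l; [exact B0|now apply sum_npow_tail]. }
rewrite <- (sum_n_scal_l (K := R_Ring) (V := R_ModuleSpace)).
apply (norm_sum_n_le (X := X)); intros k _.
change (@scal R_Ring R_ModuleSpace B ?x) with (B * x).
destruct (Rlt_dec _ _).
- apply Rle_trans with 0; [apply Req_le, (@norm_zero C_AbsRing X)|lra].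
- assert (h := norm_term_le z k); rewrite Hz in h; exact h.
Qed.

Lemma pow_fact_le_exp (x : R) (n : nat) : 0 <= x -> x ^ n / INR (fact n) <= exp x.
Proof.
intros x0; apply Rle_trans with (2 := exp_ge_taylor x n x0).
destruct n as [|n]; [simpl; lra|]; rewrite tech5.
assert (0 <= sum_f_R0 (fun k => x ^ k / INR (fact k)) n); [|lra].
apply cond_pos_sum; intros k; apply Rmult_le_pos; [now apply pow_le|].
apply Rlt_le, Rinv_0_lt_compat, INR_fact_lt_0.
Qed.

(* The coefficients are [sum_k (-log n)^m / m! a_n n^(-z0)] with [n = k + 1]; the remainder
   of order [N] is [O(2^(-N))] since [(2|w| log n)^N / N! <= n^(2|w|)]. *)
Lemma dirichlet_series_analytic : analytic_on right_half_plane f.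
Proof.
intros z0 Hz0; unfold right_half_plane in Hz0.
set (L := fun k => ln (INR (S k))).
assert (L0 : forall k, 0 <= L k) by (intros k; apply ln_INR_S_nonneg).
set (p := fun m k => (RtoC (/ INR (fact m)) * RtoC (- L k) ^ m)%C).
assert (Exc : forall m, exists c : X, is_series (fun k => scal (p m k) (term z0 k)) c).
(* Half of the decay is given away: [(r log n)^m / m! <= n^r] trades the logarithms for a power. *)
{ intros m; set (r := Re z0 / 2).
  assert (r0 : 0 < r) by (unfold r; lra).
  apply (ex_series_scaled_term z0 (p m) (/ r ^ m) r r0); intros k.
  unfold p; rewrite Cmod_mult, Cmod_pow, !Cmod_R, Rabs_Ropp.
  rewrite (Rabs_pos_eq (L k)) by apply L0.
  rewrite Rabs_pos_eq by (apply Rlt_le, Rinv_0_lt_compat, INR_fact_lt_0).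
  replace (Re z0 - r) with r by (unfold r; field).
  assert (rm : 0 < r ^ m) by now apply pow_lt.
  apply Rmult_le_reg_l with (1 := rm).
  rewrite <- (Rmult_assoc (r ^ m) (/ r ^ m)), Rinv_r, Rmult_1_l by lra.
  replace (r ^ m * (/ INR (fact m) * L k ^ m)) with ((r * L k) ^ m / INR (fact m))
    by (rewrite Rpow_mult_distr; unfold Rdiv; ring).
  apply pow_fact_le_exp, Rmult_le_pos; [lra|apply L0]. }
set (c := fun m => iota (is_series (fun k => scal (p m k) (term z0 k))) : X).
assert (Hc : forall m, is_series (fun k => scal (p m k) (term z0 k)) (c m)).
{ intros m; destruct (Exc m) as [l Hl]; apply (iota_correct (V := X)
    (is_series (fun k => scal (p m k) (term z0 k)))).
  exists l; split; [exact Hl|].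
  intros l' Hl'; exact (is_series_unique_C (X := X) _ _ _ Hl Hl'). }
exists (Re z0 / 6), c; split; [lra|]; intros z Hz.
set (w := (z - z0)%C) in *.
assert (w0 := Cmod_ge_0 w).
(* Only finitely many orders are interchanged with the sum over [n]; the limit in the order is left
   to the remainder estimate. *)
assert (Hpart : forall N,
  is_series (fun k => scal (Cexp_poly N (w * RtoC (- L k))%C) (term z0 k))
    (sum_n (fun m => scal (pow_n (K := C_AbsRing) w m) (c m)) N)).
{ assert (Ew : forall m k, (RtoC (/ INR (fact m)) * (w * RtoC (- L k)) ^ m)%C =
      (w ^ m * p m k)%C).
  { intros m k; unfold p; rewrite Cpow_mult_l; ring. }
  induction N as [|N IH].
  - rewrite sum_O, pow_n_Cpow.
    apply (is_series_ext (V := X)) with (fun k => scal (w ^ 0)%C (scal (p O k) (term z0 k))).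
    + intros k; unfold Cexp_poly; rewrite sum_O, Ew; module_ring.
    + apply (is_series_scal (V := X)), Hc.
  - rewrite sum_Sn, pow_n_Cpow.
    apply (is_series_ext (V := X)) with (fun k =>
      plus (scal (Cexp_poly N (w * RtoC (- L k))%C) (term z0 k))
           (scal (w ^ S N)%C (scal (p (S N) k) (term z0 k)))).
    + intros k; unfold Cexp_poly; rewrite sum_Sn, Ew; change plus with Cplus at 2.
      module_ring.
    + apply (is_series_plus (V := X)); [exact IH|].
      apply (is_series_scal (V := X)), Hc. }
assert (Hf : is_series (fun k => scal (Cexp (w * RtoC (- L k))%C) (term z0 k)) (f z)).
{ apply (is_series_ext (V := X)) with (term z).
  - intros k; unfold L; rewrite <- term_shift; f_equal; unfold w; ring.
  - apply dirichlet_series_correct; unfold right_half_plane.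
    replace z with (z0 + w)%C by (unfold w; ring).
    rewrite re_plus; assert (h := re_le_Cmod w).
    assert (h' := Rle_abs (- Re w)); rewrite Rabs_Ropp in h'; lra. }
(* The remainder costs [n^(3|w|)]: one [|w|] from the factor [e^(|w| log n)] in Taylor's estimate
   and two from the bound on the power over the factorial. The radius [Re z0 / 6] keeps [s] above
   [Re z0 / 2]. *)
set (s := Re z0 - 3 * Cmod w).
assert (s0 : Re z0 / 2 < s) by (unfold s; lra).
assert (Hrem : forall N, norm (minus (f z)
    (sum_n (fun m => scal (pow_n (K := C_AbsRing) w m) (c m)) N)) <=
    B * (/ s + 1) * (/ 2) ^ S N).
{ intros N.
  apply (is_series_norm_le (X := X)) with
    (fun k => scal (Cexp (w * RtoC (- L k)) - Cexp_poly N (w * RtoC (- L k)))%C (term z0 k)).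
  - apply (is_series_ext (V := X)) with
      (fun k => minus (scal (Cexp (w * RtoC (- L k))%C) (term z0 k))
         (scal (Cexp_poly N (w * RtoC (- L k))%C) (term z0 k))).
    + intros k; module_ring.
    + apply (is_series_plus (V := X)); [exact Hf|].
      apply (is_series_opp (V := X)), Hpart.
  - intros K.
    apply Rle_trans with (B * (/ 2) ^ S N * sum_n (fun k => npow k (- (1 + s))) K).
    + rewrite <- (sum_n_scal_l (K := R_Ring) (V := R_ModuleSpace)).
      apply (norm_sum_n_le (X := X)); intros k _.
      change (@scal R_Ring R_ModuleSpace ?y ?x) with (y * x).
      apply Rle_trans with (1 := @norm_scal_C X _ _).
      replace (B * (/ 2) ^ S N * npow k (- (1 + s))) with
        ((/ 2) ^ S N * npow k (3 * Cmod w) * (B * npow k (- (1 + Re z0)))).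
      2:{ replace (- (1 + s)) with (3 * Cmod w + - (1 + Re z0)) by (unfold s; ring).
          rewrite npow_plus; ring. }
      apply Rmult_le_compat; [apply Cmod_ge_0|apply norm_ge_0| |apply norm_term_le].
      apply Rle_trans with (1 := Cexp_taylor N _).
      rewrite Cmod_mult, Cmod_R, Rabs_Ropp, (Rabs_pos_eq (L k)) by apply L0.
      assert (x0 : 0 <= Cmod w * L k) by (apply Rmult_le_pos; [exact w0|apply L0]).
      replace (3 * Cmod w) with (2 * Cmod w + Cmod w) by ring.
      rewrite npow_plus; unfold npow; fold (L k).
      rewrite <- Rmult_assoc; apply Rmult_le_compat_r; [apply Rlt_le, exp_pos|].
      assert (h := pow_fact_le_exp (2 * (Cmod w * L k)) (S N) ltac:(lra)).
      replace (2 * Cmod w * L k) with (2 * (Cmod w * L k)) by ring.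
      replace ((Cmod w * L k) ^ S N / INR (fact (S N))) with
        ((/ 2) ^ S N * ((2 * (Cmod w * L k)) ^ S N / INR (fact (S N)))).
      * apply Rmult_le_compat_l; [apply pow_le; lra|exact h].
      * unfold Rdiv; rewrite <- Rmult_assoc, <- Rpow_mult_distr.
        do 2 f_equal; field.
    + replace (B * (/ s + 1) * (/ 2) ^ S N) with (B * (/ 2) ^ S N * (/ s + 1)) by ring.
      apply Rmult_le_compat_l; [|apply sum_npow_le; lra].
      apply Rmult_le_pos; [exact B0|apply pow_le; lra]. }
apply (proj2 (filterlim_locally_ball_norm (K := C_AbsRing) (U := X) _ (f z))).
intros eps.
destruct (half_pow_lt (B * (/ s + 1)) eps (cond_pos eps)) as [N0 HN0].
exists N0; intros N HN; unfold ball_norm.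
specialize (Hrem N).
change (norm (minus (sum_n (fun m => scal (pow_n (K := C_AbsRing) w m) (c m)) N) (f z)) < eps).
set (y := sum_n _ N) in *.
rewrite <- (@norm_opp C_AbsRing X).
replace (opp _) with (minus (f z) y) by module_ring.
apply Rle_lt_trans with (1 := Hrem), Rle_lt_trans with (2 := HN0).
apply Rmult_le_compat_l.
- apply Rmult_le_pos; [exact B0|].
  assert (0 < / s) by (apply Rinv_0_lt_compat; lra); lra.
- replace (S N) with (N0 + (S N - N0))%nat by lia; rewrite pow_add.
  assert (h1 : 0 < (/ 2) ^ N0) by (apply pow_lt; lra).
  assert (h2 : (/ 2) ^ (S N - N0) <= 1)
    by (rewrite <- (pow1 (S N - N0)); apply pow_incr; lra).
  nra.
Qed.
End dirichlet.

(** * Newman's contour *)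

(* The part of the contour in the left half plane is deformed separately for
   the two summands of [q]: as far as [-T] for [s], only to [-d] for [p]. *)
Lemma contour_bound {X : CompleteNormedModule C_AbsRing} (q p s : C -> X)
  (d T A1 A2 A3 A4 A5 A6 : R) :
  0 < d <= T -> (forall z, q z = minus (p z) (s z)) ->
  (forall x y, - d <= x <= T -> - T <= y <= T -> (x, y) <> RtoC 0 -> holo_at p (x, y)) ->
  (forall z, z <> RtoC 0 -> holo_at s z) ->
  (forall x y, 0 <= x <= T -> y = T \/ y = - T -> norm (q (x, y)) <= A1) ->
  (forall y, - T <= y <= T -> norm (q (T, y)) <= A2) ->
  (forall x y, - d <= x <= 0 -> y = T \/ y = - T -> norm (p (x, y)) <= A3) ->
  (forall y, - T <= y <= T -> norm (p (- d, y)) <= A4) ->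
  (forall x y, - T <= x <= 0 -> y = T \/ y = - T -> norm (s (x, y)) <= A5) ->
  (forall y, - T <= y <= T -> norm (s (- T, y)) <= A6) ->
  norm (rect q (- d) T (- T) T) <= 2 * T * (A1 + A2 + A4 + A5 + A6) + 2 * d * A3.
Proof.
intros Hd Eq Hp Hs B1 B2 B3 B4 B5 B6.
assert (Hq : forall x y, - d <= x <= T -> - T <= y <= T -> (x, y) <> RtoC 0 ->
  holo_at q (x, y)).
{ intros x y hx hy h0; apply holo_at_ext with (fun z => minus (p z) (s z)).
  - intros z; symmetry; apply Eq.
  - apply (holo_at_minus (X := X) p s); [now apply Hp|now apply Hs]. }
assert (Z : forall x y, y = T \/ y = - T -> ((x, y) : C) <> RtoC 0)
  by (intros; apply pair_neq_0; lra).
assert (S0 : rect s (- T) (- d) (- T) T = zero).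
{ apply rect_holo_zero; try lra; intros x y hx hy; apply Hs, pair_neq_0; lra. }
assert (Cs : forall y, y = T \/ y = - T ->
  hint s y (- T) 0 = plus (hint s y (- T) (- d)) (hint s y (- d) 0)).
{ intros y hy; apply XInt_Chasles; try lra.
  apply cont_hint; intros; now apply Hs, Z. }
assert (Cq : forall y, y = T \/ y = - T ->
  hint q y (- d) T = plus (hint q y (- d) 0) (hint q y 0 T)).
{ intros y hy; apply XInt_Chasles; try lra.
  apply cont_hint; intros; apply Hq; [lra|lra|now apply Z]. }
assert (Mh : forall y, y = T \/ y = - T ->
  hint q y (- d) 0 = minus (hint p y (- d) 0) (hint s y (- d) 0)).
{ intros y hy; unfold hint; rewrite <- XInt_minus; try lra.
  - apply XInt_ext; [lra|intros; apply Eq].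
  - apply cont_hint; intros; apply Hp; [lra|lra|now apply Z].
  - apply cont_hint; intros; now apply Hs, Z. }
assert (Mv : vint q (- d) (- T) T = minus (vint p (- d) (- T) T) (vint s (- d) (- T) T)).
{ unfold vint; rewrite <- XInt_minus; try lra.
  - apply XInt_ext; [lra|intros; rewrite Eq; module_ring].
  - apply cont_vint; intros; apply Hp; [lra|lra|apply pair_neq_0; lra].
  - apply cont_vint; intros; apply Hs, pair_neq_0; lra. }
assert (E : rect q (- d) T (- T) T =
  plus (plus (plus (hint q (- T) 0 T) (vint q T (- T) T)) (opp (hint q T 0 T)))
  (plus (plus (plus (hint p (- T) (- d) 0) (opp (vint p (- d) (- T) T))) (opp (hint p T (- d) 0)))
  (plus (plus (opp (hint s (- T) (- T) 0)) (vint s (- T) (- T) T)) (hint s T (- T) 0)))).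
{ rewrite !Cs by lra.
  (* Adding the zero integral of [s] around [[-T, -d] x [-T, T]] moves the left side of its contour
     from [-d] to [-T]. The pole at 0 stays outside this rectangle. *)
  replace (vint s (- T) (- T) T) with
    (plus (vint s (- T) (- T) T) (rect s (- T) (- d) (- T) T))
    by (rewrite S0; module_ring).
  unfold rect; rewrite !Cq, !Mh, Mv by lra; module_ring. }
rewrite E.
assert (tri : forall (u v : X) (a b : R), norm u <= a -> norm v <= b ->
  norm (plus u v) <= a + b).
{ intros u v a b hu hv; apply Rle_trans with (1 := @norm_triangle C_AbsRing X _ _); lra. }
assert (nopp : forall (u : X) (a : R), norm u <= a -> norm (opp u) <= a).
{ intros u a hu; rewrite (@norm_opp C_AbsRing X); exact hu. }
assert (Hqy : forall x y, 0 <= x <= T -> y = T \/ y = - T -> holo_at q (x, y))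
  by (intros x y hx hy; apply Hq; [lra|lra|now apply Z]).
assert (Hpy : forall x y, - d <= x <= 0 -> y = T \/ y = - T -> holo_at p (x, y))
  by (intros x y hx hy; apply Hp; [lra|lra|now apply Z]).
assert (hq : forall y, y = T \/ y = - T -> norm (hint q y 0 T) <= (T - 0) * A1).
{ intros y hy; apply hint_norm_le; [lra| |]; intros x hx; [now apply Hqy|now apply B1]. }
assert (hp : forall y, y = T \/ y = - T -> norm (hint p y (- d) 0) <= (0 - - d) * A3).
{ intros y hy; apply hint_norm_le; [lra| |]; intros x hx; [now apply Hpy|now apply B3]. }
assert (hs : forall y, y = T \/ y = - T -> norm (hint s y (- T) 0) <= (0 - - T) * A5).
{ intros y hy; apply hint_norm_le; [lra| |]; intros x hx; [now apply Hs, Z|now apply B5]. }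
assert (vq : norm (vint q T (- T) T) <= (T - - T) * A2).
{ apply vint_norm_le; [lra| |exact B2]; intros y hy; apply Hq; [lra|lra|].
  apply pair_neq_0; lra. }
assert (vp : norm (vint p (- d) (- T) T) <= (T - - T) * A4).
{ apply vint_norm_le; [lra| |exact B4]; intros y hy; apply Hp; [lra|lra|].
  apply pair_neq_0; lra. }
assert (vs : norm (vint s (- T) (- T) T) <= (T - - T) * A6).
{ apply vint_norm_le; [lra| |exact B6]; intros y hy; apply Hs, pair_neq_0; lra. }
assert (yT : - T = T \/ - T = - T) by now right.
assert (yT' : T = T \/ T = - T) by now left.
assert (bound := tri _ _ _ _
  (tri _ _ _ _ (tri _ _ _ _ (hq _ yT) vq) (nopp _ _ (hq _ yT')))
  (tri _ _ _ _
    (tri _ _ _ _ (tri _ _ _ _ (hp _ yT) (nopp _ _ vp)) (nopp _ _ (hp _ yT')))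
    (tri _ _ _ _ (tri _ _ _ _ (nopp _ _ (hs _ yT)) vs) (hs _ yT')))).
apply Rle_trans with (1 := bound); lra.
Qed.

(* Newman's kernel, which vanishes at [iT] and [-iT]. *)
Definition kernel (t T : R) (z : C) : C :=
  (Cexp (z * RtoC t) * (1 + z * z * RtoC (/ T ^ 2)))%C.

Lemma kernel_0 (t T : R) : kernel t T (RtoC 0) = RtoC 1.
Proof.
unfold kernel; replace (RtoC 0 * RtoC t)%C with (RtoC 0) by ring.
rewrite Cexp_0; ring.
Qed.

Lemma holo_at_kernel (t T : R) (z : C) :
  holo_at (X := C_NormedModule) (kernel t T) z.
Proof.
apply (holo_at_scal (X := C_NormedModule) (fun z => Cexp (z * RtoC t)%C)
  (fun z => 1 + z * z * RtoC (/ T ^ 2))%C); [apply holo_at_Cexp_scal|].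
apply (holo_at_plus (X := C_NormedModule) (fun _ => RtoC 1)
  (fun z => z * z * RtoC (/ T ^ 2))%C); [apply (@holo_at_const C_NormedModule)|].
apply (holo_at_scal (X := C_NormedModule) (fun z => z * z)%C (fun _ => RtoC (/ T ^ 2)));
  [|apply (@holo_at_const C_NormedModule)].
apply (holo_at_scal (X := C_NormedModule) (fun z => z) (fun z => z)); apply holo_at_id.
Qed.

Lemma Cmod_div_kernel (t T : R) (x y K : R) : ((x, y) : C) <> RtoC 0 ->
  Cmod (1 + (x, y) * (x, y) * RtoC (/ T ^ 2))%C <= K * Cmod (x, y) ->
  Cmod (/ (x, y) * kernel t T (x, y))%C <= exp (x * t) * K.
Proof.
intros h0 H; unfold kernel.
assert (c0 : 0 < Cmod (x, y)) by now apply Cmod_gt_0.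
rewrite !Cmod_mult, Cmod_Cexp, Cmod_inv by exact h0.
rewrite re_scal_r; cbn [Re fst].
apply Rmult_le_reg_l with (1 := c0).
rewrite <- !Rmult_assoc, Rinv_r, Rmult_1_l by lra.
rewrite (Rmult_comm (Cmod (x, y))), Rmult_assoc.
rewrite (Rmult_comm (Cmod (x, y))).
apply Rmult_le_compat_l; [apply Rlt_le, exp_pos|exact H].
Qed.

Lemma Cmod_ge_Re (x y : R) : Rabs x <= Cmod (x, y).
Proof. exact (re_le_Cmod (x, y)). Qed.

Lemma Cmod_ge_Im (x y : R) : Rabs y <= Cmod (x, y).
Proof. apply Rle_trans with (2 := Rmax_Cmod (x, y)), Rmax_r. Qed.

(** Since [y^2 = T^2], the polynomial factor equals [x (x + 2iy) / T^2], and
    [|x + 2iy| <= 3T <= 3 |z|]. *)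
Lemma Cmod_kernel_horizontal (t T x y : R) : 0 < T -> y = T \/ y = - T -> - T <= x <= T ->
  Cmod (/ (x, y) * kernel t T (x, y))%C <= exp (x * t) * (3 * Rabs x / T ^ 2).
Proof.
intros T0 hy hx; apply Cmod_div_kernel; [apply pair_neq_0; lra|].
replace (1 + (x, y) * (x, y) * RtoC (/ T ^ 2))%C with
  (RtoC (x / T ^ 2) * (RtoC x + Ci * RtoC (2 * y)))%C.
2:{ unfold RtoC, Ci, Cplus, Cmult; simpl.
    destruct hy as [-> | ->]; f_equal; field; lra. }
rewrite Cmod_mult, Cmod_R.
assert (h := Cmod_triangle (RtoC x) (Ci * RtoC (2 * y))%C).
rewrite Cmod_mult, Cmod_Ci, !Cmod_R in h.
assert (hy' : Rabs y = T)
  by (destruct hy as [-> | ->]; [|rewrite Rabs_Ropp]; apply Rabs_pos_eq; lra).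
rewrite Rabs_mult, (Rabs_pos_eq 2), hy' in h by lra.
assert (hx' : Rabs x <= T) by (apply Rabs_le; lra).
assert (hc := Cmod_ge_Im x y); rewrite hy' in hc.
assert (x0 := Rabs_pos x).
assert (T2 : 0 < T ^ 2) by (apply pow_lt; lra).
replace (Rabs (x / T ^ 2)) with (Rabs x / T ^ 2)
  by (unfold Rdiv; rewrite Rabs_mult, Rabs_inv, (Rabs_pos_eq (T ^ 2)); lra).
replace (3 * Rabs x / T ^ 2 * Cmod (x, y)) with (Rabs x / T ^ 2 * (3 * Cmod (x, y)))
  by (field; lra).
apply Rmult_le_compat_l; [|lra].
apply Rmult_le_pos; [exact x0|]; now apply Rlt_le, Rinv_0_lt_compat.
Qed.

(** In the square [|z|^2 <= 2 T^2], so the polynomial factor is at most 3; [1/|z|] is at most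
    [1/|x|]. *)
Lemma Cmod_kernel_vertical (t T x y : R) : x <> 0 -> - T <= y <= T -> - T <= x <= T ->
  Cmod (/ (x, y) * kernel t T (x, y))%C <= exp (x * t) * (3 / Rabs x).
Proof.
intros x0 hy hx; apply Cmod_div_kernel; [apply pair_neq_0; lra|].
assert (T0 : 0 < T) by lra.
assert (a0 : 0 < Rabs x) by now apply Rabs_pos_lt.
assert (hc := Cmod_ge_Re x y).
assert (T2 : 0 < T ^ 2) by (apply pow_lt; lra).
apply Rle_trans with 3.
2:{ replace 3 with (3 / Rabs x * Rabs x) at 1 by (field; lra).
    apply Rmult_le_compat_l; [apply Rlt_le, Rdiv_lt_0_compat; lra|exact hc]. }
apply Rle_trans with (1 := Cmod_triangle _ _).
rewrite Cmod_1, !Cmod_mult, Cmod_R, (Rabs_pos_eq (/ T ^ 2))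
  by now apply Rlt_le, Rinv_0_lt_compat.
assert (E : Cmod (x, y) * Cmod (x, y) = x ^ 2 + y ^ 2).
{ unfold Cmod; apply sqrt_sqrt; simpl; nra. }
rewrite E.
assert (h : x ^ 2 + y ^ 2 <= 2 * T ^ 2) by nra.
assert (h2 := Rmult_le_compat_r _ _ _ (Rlt_le _ _ (Rinv_0_lt_compat _ T2)) h).
replace (2 * T ^ 2 * / T ^ 2) with 2 in h2 by (field; lra); lra.
Qed.

(** The factor 2 puts the closed strip inside a region whose left boundary is excluded; as [M] is
    increasing, its value at [T] gives a width valid at all heights up to [T]. *)
Lemma strip_in_region_Q (M : R -> R) (T x y : R) :
  (forall x, 0 <= x -> 1 <= M x) -> (forall x y, 0 <= x -> x <= y -> M x <= M y) ->
  - T <= y <= T -> - / (2 * M T) <= x <= 0 -> region_Q M (x, y).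
Proof.
intros M1 Mi hy hx; unfold region_Q; cbn [Re Im fst snd].
split; [lra|].
assert (y0 := Rabs_pos y).
assert (m1 := M1 _ y0).
assert (m2 := Mi _ T y0 ltac:(apply Rabs_le; lra)).
assert (h : / (2 * M T) < 1 / M (Rabs y)).
{ unfold Rdiv; rewrite Rmult_1_l; apply Rinv_lt_contravar; [nra|lra]. }
lra.
Qed.

(** From [t = 4 M_log(T)] and the width [1 / (2 M T)] the exponent is minus twice the bracket in
    [M_log]: hence the square of [T M T], while the coefficient [1/2] of [ln (5 c)] becomes 1. *)
Lemma exp_M_log (M : R -> R) (c t T : R) : 0 < c -> 1 <= T -> 1 <= M T ->
  M_log M c T = t / 4 -> exp (- / (2 * M T) * t) = 5 * c / (T * M T) ^ 2.
Proof.
intros c0 T1 m1 H; unfold M_log in H.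
replace (- / (2 * M T) * t) with (ln (5 * c) + - (ln T + ln (M T) + (ln T + ln (M T)))).
- rewrite exp_plus, exp_Ropp, !exp_plus, !exp_ln by lra.
  field; lra.
- replace t with (4 * (t / 4)) by field; rewrite <- H; field; lra.
Qed.

Theorem corollary4p3 (X : CompleteNormedModule C_AbsRing) (b : nat -> X)
  (hb : bounded_seq b) :
  let a : nat -> X := fun n => scal (/ RtoC (INR n))%C (b n) in
  let f : C -> X := dirichlet_series a in
  (forall z : C, right_half_plane z ->
     is_series (fun k => dirichlet_term a z (S k)) (f z)) /\
  analytic_on right_half_plane f /\
  (forall M : R -> R,
     (forall x : R, 0 <= x -> 1 <= M x) ->
     continuous_on (fun x => 0 <= x) M ->
     (forall x y : R, 0 <= x -> x <= y -> M x <= M y) ->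
     let Rt : R -> R := fun t => exp t in
     let c : R := exp 1 * Rmax (sup_norm b) 1 in
     forall F : C -> X,
       analytic_extension (region_Q M) f F ->
       (forall z : C, region_Q M z -> norm (F z) <= M (Rabs (Im z))) ->
       exists K T' : R, 0 < K /\ 0 <= T' /\
         forall t : R, T' < t ->
           norm (minus (sum_log_lt a t) (F (RtoC 0))) <=
             K * Rmax (1 / M_log_inv M c (t / 4)) (1 / Rt t)).
Proof.
intros a f.
assert (HB : exists B, 0 <= B /\ forall n, (1 <= n)%nat -> norm (b n) <= B).
{ destruct hb as [B HB]; exists B; split; [|exact HB].
  apply Rle_trans with (2 := HB 1%nat (le_n _)), norm_ge_0. }
destruct HB as (B & B0 & HB).
split; [|split].
{ exact (dirichlet_series_correct b B HB). }
{ exact (dirichlet_series_analytic b B B0 HB). }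
intros M M1 Mc Mi Rt c F [HF HFa] HFb.
assert (c0 : 0 < c).
{ unfold c; apply Rmult_lt_0_compat; [apply exp_pos|].
  apply Rlt_le_trans with (2 := Rmax_r _ _); lra. }
destruct (M_log_inv_spec M c M1 Mc Mi) as [s0 Hs0].
(* [24 B] collects four contributions [2T A] with [A = 3 B eps / T]; [60 c] is the left side of the
   contour of [F], [2T] times [30 c / T^2]; 2 covers its horizontal sides, [3d / T^2 <= 2 / T]. The
   outer 2 turns [1/T + e^(-t)] into a maximum. Beyond [4 s0] the inverse of [M_log] is defined at
   [t / 4]. *)
exists (2 * (24 * B + 2 + 60 * c)), (Rmax 0 (4 * s0)).
split; [lra|split; [apply Rmax_l|]]; intros t Ht.
assert (Ht1 := Rle_lt_trans _ _ _ (Rmax_r _ _) Ht).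
destruct (Hs0 (t / 4) ltac:(lra)) as (_ & T1 & ET).
set (T := M_log_inv M c (t / 4)) in *.
assert (m1 := M1 T ltac:(lra)).
assert (Ed := exp_M_log M c t T c0 T1 m1 ET).
set (m := M T) in *; set (d := / (2 * m)).
assert (d0 : 0 < d <= / 2).
{ unfold d; split; [apply Rinv_0_lt_compat; lra|apply Rinv_le_contravar; lra]. }
assert (HQ : forall x y, - d <= x <= 0 -> - T <= y <= T -> region_Q M (x, y))
  by (intros x y hx hy; now apply strip_in_region_Q with T).
assert (Fh : forall x y, - d <= x <= T -> - T <= y <= T -> holo_at F (x, y)).
{ intros x y hx hy; apply analytic_at_holo, HFa.
  destruct (Rlt_le_dec 0 x) as [h|h]; [left; exact h|right; apply HQ; lra]. }
assert (FM : forall x y, - d <= x <= 0 -> - T <= y <= T -> norm (F (x, y)) <= m).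
{ intros x y hx hy; apply Rle_trans with (1 := HFb _ (HQ x y hx hy)).
  apply Mi; [apply Rabs_pos|apply Rabs_le; exact hy]. }
set (S := head b t).
set (eps := dirichlet_bound t T).
set (k := kernel t T).
assert (Hbound : norm (minus (F (RtoC 0)) (S (RtoC 0))) <= (24 * B + 2 + 60 * c) * eps).
{ set (h := fun z => scal (k z) (minus (F z) (S z))).
  assert (hh : holo_on (- d) T (- T) T h).
  { intros x y hx hy; apply (holo_at_scal (X := X) k (fun z => minus (F z) (S z)));
      [apply holo_at_kernel|].
    apply (holo_at_minus (X := X) F S); [now apply Fh|apply holo_at_head]. }
  replace (minus (F (RtoC 0)) (S (RtoC 0))) with (h (RtoC 0))
    by (unfold h, k; rewrite kernel_0; exact (@scal_one C_Ring X _)).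
  apply Rle_trans with (1 := rect_cauchy h (- d) T ltac:(lra) hh).
  set (A := 3 * B * eps / T).
  apply Rle_trans with (2 * T * (A + A + 30 * c / T ^ 2 + A + A) + 2 * d * (3 * d / T ^ 2 * m)).
  - assert (i0 : 0 < / T) by (apply Rinv_0_lt_compat; lra).
    assert (eps0 : 0 < eps) by (apply dirichlet_bound_pos; lra).
    assert (A0 : 0 <= A)
      by (unfold A, Rdiv; repeat apply Rmult_le_pos; lra).
    (* One estimate for [F - S] on the right and [S] on the left. The exponentials cancel, and
       [x' (1/x' + e^(-t)) / T <= 1/T + e^(-t)] because [x' <= T]. *)
    assert (Khor : forall (v : X) (x y x' : R), x' = Rabs x -> x' <= T ->
      y = T \/ y = - T ->
      (0 < x' -> norm v <= B * (exp (- (x * t)) * dirichlet_bound t x')) ->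
      norm (scal (/ (x, y) * k (x, y))%C v) <= A).
    { intros v x y x' Ex hx hy hv; apply Rle_trans with (1 := @norm_scal_C X _ _).
      assert (K1 := Cmod_kernel_horizontal t T x y ltac:(lra) hy
        ltac:(apply Rabs_le_between; lra)).
      fold k in K1; rewrite <- Ex in K1.
      assert (x0 : 0 <= x') by (rewrite Ex; apply Rabs_pos).
      destruct (Rle_lt_or_eq_dec 0 x' x0) as [hx0|hx0].
      - apply Rle_trans with (exp (x * t) * (3 * x' / T ^ 2) *
          (B * (exp (- (x * t)) * dirichlet_bound t x'))).
        { apply Rmult_le_compat; [apply Cmod_ge_0|apply norm_ge_0|exact K1|now apply hv]. }
        replace (exp (x * t) * (3 * x' / T ^ 2) *
          (B * (exp (- (x * t)) * dirichlet_bound t x'))) with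
          (3 * B * (x' * dirichlet_bound t x' / T) / T
             * (exp (x * t) * exp (- (x * t)))) by (field; lra).
        rewrite <- exp_plus, Rplus_opp_r, exp_0, Rmult_1_r.
        unfold A, Rdiv; apply Rmult_le_compat_r; [lra|].
        apply Rmult_le_compat_l; [lra|].
        unfold eps, dirichlet_bound; assert (e0 := exp_pos (- t)).
        apply Rmult_le_reg_r with T; [lra|].
        rewrite Rmult_assoc, Rinv_l, Rmult_1_r by lra.
        rewrite !Rmult_plus_distr_r, Rmult_plus_distr_l, Rinv_r, Rinv_l by lra.
        nra.
      (* On the imaginary axis no bound on [v] is available, but there the point is [iT] or [-iT]
         and the kernel vanishes. *)
      - rewrite <- hx0 in K1; unfold Rdiv in K1.
        rewrite Rmult_0_r, Rmult_0_l, Rmult_0_r in K1.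
        assert (c1 := Cmod_ge_0 (/ (x, y) * k (x, y))%C).
        replace (Cmod (/ (x, y) * k (x, y))%C) with 0 by lra; lra. }
    assert (Kver : forall (v : X) (x y : R), x = T \/ x = - T -> - T <= y <= T ->
      norm v <= B * (exp (- (x * t)) * eps) -> norm (scal (/ (x, y) * k (x, y))%C v) <= A).
    { intros v x y hx hy hv; apply Rle_trans with (1 := @norm_scal_C X _ _).
      assert (K1 := Cmod_kernel_vertical t T x y ltac:(lra) hy ltac:(lra)); fold k in K1.
      replace (Rabs x) with T in K1
        by (symmetry; destruct hx as [-> | ->]; [|rewrite Rabs_Ropp]; apply Rabs_pos_eq; lra).
      apply Rle_trans with (exp (x * t) * (3 / T) * (B * (exp (- (x * t)) * eps))).
      { apply Rmult_le_compat; [apply Cmod_ge_0|apply norm_ge_0|exact K1|exact hv]. }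
      replace (exp (x * t) * (3 / T) * (B * (exp (- (x * t)) * eps))) with
        (A * (exp (x * t) * exp (- (x * t)))) by (unfold A; field; lra).
      rewrite <- exp_plus, Rplus_opp_r, exp_0; lra. }
    assert (FS : forall x y, 0 < x ->
      norm (minus (F (x, y)) (S (x, y))) <= B * (exp (- (x * t)) * dirichlet_bound t x)).
    { intros x y hx; rewrite (HF (x, y) hx).
      now apply (norm_tail_le b B B0 HB). }
    assert (Sl : forall x y, 0 < x ->
      norm (S (- x, y)) <= B * (exp (x * t) * dirichlet_bound t x)).
    { intros x y hx; now apply (norm_head_le b B B0 HB). }
    apply contour_bound with
      (p := fun z => scal (/ z * k z)%C (F z)) (s := fun z => scal (/ z * k z)%C (S z)).
    + lra.
    + intros z; unfold h; module_ring.
    + intros x y hx hy hz.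
      apply (holo_at_ext (X := X) (fun z => scal (/ z)%C (scal (k z) (F z))));
        [intros z; module_ring|].
      apply holo_at_inv_scal; [exact hz|].
      apply (holo_at_scal (X := X) k F); [apply holo_at_kernel|now apply Fh].
    + intros z hz.
      apply (holo_at_ext (X := X) (fun z => scal (/ z)%C (scal (k z) (S z))));
        [intros z'; module_ring|].
      apply holo_at_inv_scal; [exact hz|].
      apply (holo_at_scal (X := X) k S); [apply holo_at_kernel|apply holo_at_head].
    + intros x y hx hy; unfold h.
      replace (scal _ _) with (scal (/ (x, y) * k (x, y))%C (minus (F (x, y)) (S (x, y))))
        by module_ring.
      apply Khor with x; [symmetry; apply Rabs_pos_eq; lra|lra|exact hy|].
      intros x0; now apply FS.
    + intros y hy; unfold h.
      replace (scal _ _) with (scal (/ (T, y) * k (T, y))%C (minus (F (T, y)) (S (T, y))))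
        by module_ring.
      apply Kver; [lra|exact hy|apply FS; lra].
    + intros x y hx hy; apply Rle_trans with (1 := @norm_scal_C X _ _).
      apply Rmult_le_compat; [apply Cmod_ge_0|apply norm_ge_0| |apply FM; lra].
      apply Rle_trans with (1 := Cmod_kernel_horizontal t T x y ltac:(lra) hy ltac:(lra)).
      rewrite Rabs_left1 by lra.
      assert (T2 : 0 < / T ^ 2) by (apply Rinv_0_lt_compat, pow_lt; lra).
      assert (e1 : exp (x * t) <= 1).
      { rewrite <- exp_0; apply exp_le.
        assert (t0 := Rle_lt_trans _ _ _ (Rmax_l _ _) Ht); nra. }
      rewrite <- (Rmult_1_l (3 * d / T ^ 2)).
      unfold Rdiv; apply Rmult_le_compat; [apply Rlt_le, exp_pos| |exact e1|].
      * apply Rmult_le_pos; lra.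
      * apply Rmult_le_compat_r; lra.
    + intros y hy; apply Rle_trans with (1 := @norm_scal_C X _ _).
      assert (K1 := Cmod_kernel_vertical t T (- d) y ltac:(lra) hy ltac:(lra)).
      rewrite Rabs_Ropp, (Rabs_pos_eq d) in K1 by lra.
      (* As [1/d = 2m], the product is [6 m^2 e^(-dt) = 30 c / T^2]. *)
      apply Rle_trans with (exp (- d * t) * (3 / d) * m).
      * apply Rmult_le_compat; [apply Cmod_ge_0|apply norm_ge_0|exact K1|apply FM; lra].
      * fold d in Ed; rewrite Ed; unfold d; apply Req_le; field; lra.
    + intros x y hx hy.
      apply Khor with (- x); [rewrite Rabs_left1; lra|lra|exact hy|].
      intros x0; replace x with (- - x) at 1 by ring.
      replace (- (x * t)) with (- x * t) by ring; now apply Sl.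
    + intros y hy; apply Kver; [lra|exact hy|].
      replace (- (- T * t)) with (T * t) by ring; apply Sl; lra.
  - assert (e0 := exp_pos (- t)).
    assert (i0 : 0 < / T) by (apply Rinv_0_lt_compat; lra).
    assert (ie : / T <= eps) by (unfold eps, dirichlet_bound; lra).
    replace (2 * T * (A + A + 30 * c / T ^ 2 + A + A) + 2 * d * (3 * d / T ^ 2 * m)) with
      (24 * B * eps + 60 * c * / T + 3 * d * / T * / T).
    2:{ unfold A, d; field; lra. }
    assert (i1 : / T <= 1) by (rewrite <- Rinv_1; apply Rinv_le_contravar; lra).
    assert (h1 : 3 * d * / T * / T <= 2 * / T).
    { apply Rmult_le_compat_r; [lra|nra]. }
    assert (h2 : 60 * c * / T <= 60 * c * eps) by (apply Rmult_le_compat_l; lra).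
    lra. }
unfold S in Hbound; rewrite head_0 in Hbound; fold a in Hbound.
rewrite <- (@norm_opp C_AbsRing X).
replace (opp (minus _ _)) with (minus (F (RtoC 0)) (sum_log_lt a t)) by module_ring.
apply Rle_trans with (1 := Hbound).
replace (2 * (24 * B + 2 + 60 * c) * Rmax (1 / T) (1 / Rt t)) with
  ((24 * B + 2 + 60 * c) * (2 * Rmax (1 / T) (1 / Rt t))) by ring.
apply Rmult_le_compat_l; [lra|].
assert (h1 := Rmax_l (1 / T) (1 / Rt t)); assert (h2 := Rmax_r (1 / T) (1 / Rt t)).
unfold eps, dirichlet_bound; rewrite exp_Ropp.
unfold Rdiv in *; rewrite !Rmult_1_l in *; unfold Rt in *; lra.
Qed.
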